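(* Let $\Lambda_0>0$, $\alpha>0$, $\gamma>0$, $\beta\in(0,1)$ and $\nu>0$, with $(\alpha-1)\gamma+\nu^\beta\neq 0$. Then the inverse Laplace transform $\lambda(t)=\mathcal{L}^{-1}[\tilde\lambda(s):t]$, $t\ge 0$, of $$\tilde{\lambda}(s)=\frac{\Lambda_0}{s}\left[\frac{\gamma-\nu^\beta+(\nu+s)^\beta}{\gamma(1-\alpha)-\nu^\beta+(\nu+s)^\beta}\right]$$ is given by $$\lambda(t)=\Lambda_0\left[\frac{\nu^\beta-\gamma}{(\alpha-1)\gamma+\nu^\beta}+\frac{\alpha\gamma e^{-\nu t}}{(\alpha-1)\gamma+\nu^\beta}\sum_{m=0}^{\infty}\nu^m t^m M^1_{\beta,m+1}\big(((\alpha-1)\gamma+\nu^\beta)t^\beta\big)\right].$$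
   Context: For $a,b,c\in\mathbb{C}$ with positive real parts, the generalized Mittag-Leffler function is $M^c_{a,b}(z)=\sum_{n=0}^\infty \frac{(c)_n}{\Gamma(an+b)}\frac{z^n}{n!}$, $z\in\mathbb{C}$, where $(c)_n=c(c+1)\cdots(c+n-1)$ is the Pochhammer symbol; thus $M^1_{a,b}(z)=\sum_{n=0}^\infty \frac{z^n}{\Gamma(an+b)}$. The Laplace transform is $\mathcal{L}[f(t):s]=\tilde f(s)=\int_0^\infty e^{-st}f(t)\,dt$. The inverse Laplace transform of $\tilde\lambda$ is the continuous function $\lambda$ on $[0,\infty)$ whose Laplace transform equals $\tilde\lambda(s)$ for all $s$ with sufficiently large real part (principal branch of the power). Background: $\lambda(t)=\mathbb{E}[\Lambda(t|\mathcal{H}_t)]$ is the expected conditional intensity of the Hawkes process with intensity $\Lambda(t|\mathcal{H}_t)=\Lambda_0+\alpha\int_0^t f(t-u)\,dN(u)$, whose kernel $f$ is the (time-rescaled by the factor $\gamma$) tempered Mittag-Leffler density, with Laplace transform $\frac{\gamma}{\gamma-\nu^\beta+(\nu+s)^\beta}$. This gives the displayed $\tilde\lambda(s)$. *)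

(* Defs.v *)
(* MathComp-Analysis, over an abstract R : realType; complex numbers are R[i]. *)
From HB Require Import structures.
From mathcomp Require Import all_boot all_order all_algebra.
From mathcomp Require Import all_classical all_reals all_analysis.
From mathcomp Require Import complex.

Set Implicit Arguments.
Unset Strict Implicit.
Unset Printing Implicit Defensive.

Import Order.TTheory GRing.Theory Num.Theory.
Import numFieldNormedType.Exports.

Local Open Scope classical_set_scope.
Local Open Scope ring_scope.
Local Open Scope complex_scope.

Section ComplexAnalysis.
Variable R : realType.
Implicit Types (z w s a b c : R[i]) (D : set R) (f : R -> R[i]).

Definition cexp z : R[i] :=
  (expR (complex.Re z) * cos (complex.Im z)) +i*
  (expR (complex.Re z) * sin (complex.Im z)).

(* Principal argument, in ]-pi, pi] for z != 0; negative reals get pi. *)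
Definition carg z : R :=
  let theta := acos (complex.Re z / complex.Re `|z|) in
  if 0 <= complex.Im z then theta else - theta.

Definition clog z : R[i] := ln (complex.Re `|z|) +i* carg z.

(* Principal branch. At z = 0 the value follows the convention of powR. *)
Definition cpow z w : R[i] :=
  if z == 0 then (w == 0)%:R else cexp (w * clog z).

(* Lebesgue integration of complex-valued functions of a real variable. *)
Definition cintegrable D f : Prop :=
  (@lebesgue_measure R).-integrable D (fun t => (complex.Re (f t))%:E) /\
  (@lebesgue_measure R).-integrable D (fun t => (complex.Im (f t))%:E).

Definition cintegral D f : R[i] :=
  Rintegral (@lebesgue_measure R) D (fun t => complex.Re (f t)) +i*
  Rintegral (@lebesgue_measure R) D (fun t => complex.Im (f t)).

(* Euler's integral; it is the Gamma function only for 0 < Re z, the only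
   arguments needed by the Mittag-Leffler function below. *)
Definition cGamma z : R[i] :=
  cintegral `]0, +oo[ (fun t => cpow t%:C (z - 1) * (expR (- t))%:C).

Definition pochhammer c (n : nat) : R[i] := \prod_(i < n) (c + i%:R).

(* R[i]^o carries the topology of the norm of R[i]. *)
Definition csum (u : nat -> R[i]) : R[i] := limn (series (u : nat -> R[i]^o)).

Definition mittag_leffler a b c z : R[i] :=
  csum (fun n => pochhammer c n / cGamma (a * n%:R + b) * (z ^+ n / n`!%:R)).

Definition laplace_integrand f s (t : R) : R[i] := cexp (- (s * t%:C)) * f t.

Definition laplace f s : R[i] := cintegral `[0, +oo[ (laplace_integrand f s).

(* f is the inverse Laplace transform of F. Only the values of f on [0, +oo[
   matter. Absolute convergence of the Laplace integral is required, because
   cintegral is total. *)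
Definition is_inverse_laplace (F : R[i] -> R[i]) f : Prop :=
  {within `[0, +oo[, continuous (f : R -> R[i]^o)} /\
  exists sigma : R, forall s, sigma < complex.Re s ->
    cintegrable `[0, +oo[ (laplace_integrand f s) /\ laplace f s = F s.

End ComplexAnalysis.

(* Main.v *)
Require Import Defs.
From mathcomp Require Import all_boot all_order all_algebra.
From mathcomp Require Import all_classical all_reals all_analysis.
From mathcomp Require Import complex.
From mathcomp Require Import measurable_realfun ring lra.
Import Order.TTheory GRing.Theory Num.Theory.
Import numFieldNormedType.Exports.
Import ComplexField.Normc.
Local Open Scope classical_set_scope.
Local Open Scope ring_scope.
Local Open Scope complex_scope.

(** Write c = (alpha - 1) gamma + nu^beta and z = s + nu.  The claimed function is
    a constant plus a multiple of exp(- nu t) times the double series of the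
    monomials
      nu^m c^n t^(beta n + m) / Gamma(beta n + m + 1).
    For real p >= 1 the transform of t^(p - 1) / Gamma(p) is z^(- p)
    ([laplace_power]), so that, term by term, the transform at z is the product
    of two geometric series,
      z^-1 / ((1 - c z^(- beta)) (1 - nu / z)) = z^beta / (s (z^beta - c)),
    and adding the constant term and reducing to a common denominator yields the
    given transform ([laplace_intensity]).  The equivalence then amounts to the
    fact that this function is an inverse transform and that a continuous
    inverse transform is unique.

    Three points carry the proof.

    - The formula for the transform of a power at complex z = x + i y.  At
      y = 0 it is a change of variable.  Integration by parts gives
      z I_(p+1)(z) = p I_p(z) for I_p(z) the integral of t^(p - 1) exp(- z t),
      and d/dy I_p = - i I_(p+1); together they say that z^p I_p(z) has zero
      derivative in y ([osc_integral_pow_const]).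

    - The exchange of sums and integrals.  Restricting the Gamma integral to
      [T, T + 1] gives 1 / Gamma(p) <= exp(T + 1) T^(1 - p) for every T > 0
      ([euler_gamma_ge]).  With T = K (t + 1) each term of the double series is
      at most a constant times exp(K t) q1^n q2^m, where q1 = |c| / K^beta and
      q2 = nu / K are smaller than 1 as soon as K is large
      ([double_term_bounded]).  This one bound gives convergence, continuity,
      exponential growth and termwise transformation, by applying twice the
      results on series dominated by a geometric one
      ([laplace_geometric_series]).

    - Uniqueness ([lerch_eq0]), by the argument of Phragmen.  If the transform
      of g vanishes at all large reals, expanding the exponential series shows
      that the integral of (exp(- exp(k (t - u))) - 1) g(u) vanishes for large
      k.  As k tends to infinity the kernel tends to - 1 for u < t and to 0 for
      u > t, hence the primitive of g from 0 vanishes, and so does g. *)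

Set Implicit Arguments.
Unset Strict Implicit.

(** * Functions of exponential growth on the half-line *)

Section DampedIntegrals.
Context {R : realType}.
Notation mu := (@lebesgue_measure R).
Notation halfline := (`[0%R, +oo[%classic : set R).
Implicit Types (f k : R -> R) (a x C K : R).

Definition exp_bounded K C f := forall t, 0 <= t -> `|f t| <= C * expR (K * t).

Lemma within_halfline_measurable f :
  {within halfline, continuous f} -> measurable_fun halfline f.
Proof. exact: subspace_continuous_measurable_fun. Qed.

Lemma integrable_mull c f : mu.-integrable halfline (EFin \o f) ->
  mu.-integrable halfline (EFin \o (fun t => c * f t)).
Proof.
move=> intf.
apply: (@eq_integrable _ _ _ mu _ _ (fun t => (c%:E * (EFin \o f) t)%E)) => //.
exact: integrableZl.
Qed.

Lemma integrable_expN a : 0 < a ->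
  mu.-integrable halfline (EFin \o (fun t => expR (- (a * t)))) /\
  \int[mu]_(t in halfline) expR (- (a * t)) = a^-1.
Proof.
move=> a0.
have pdfE t : t \in halfline ->
    (expR (- (a * t)))%:E = (a^-1 * exponential_pdf a t)%:E.
  rewrite inE/= in_itv/= andbT => t0.
  by rewrite exponential_pdfE// mulNr mulKf ?gt_eqF.
have intpdf : mu.-integrable halfline (EFin \o exponential_pdf a).
  by apply: integrableS (integrable_exponential_pdf a0).
split.
  apply: (@eq_integrable _ _ _ mu _ _
    (fun t => (a^-1)%:E * (EFin \o exponential_pdf a) t)%E) => //.
    by move=> t t0; rewrite /= pdfE// EFinM.
  exact: integrableZl.
rewrite /Rintegral; under eq_integral => t th do rewrite pdfE// EFinM.
rewrite integralZl//= fineM ?integrable_fin_num//.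
rewrite (_ : fine (integral _ _ _) = 1) ?mulr1//.
have /(congr1 fine) /= <- := integral_exponential_pdf a0.
congr fine; rewrite [LHS]integral_mkcond; apply: eq_integral => t _.
rewrite patchE; case: ifPn => // th.
rewrite lt0_exponential_pdf// ltNge; apply: contra th => t0.
by rewrite inE/= in_itv/= t0.
Qed.

(** The product is dominated by C exp(- (x - K) t).  The kernel [k] is the real
    or imaginary part of exp(- s t), with x = Re s. *)
Lemma damped_integrable k f x K C :
    measurable_fun halfline k -> measurable_fun halfline f ->
    (forall t, 0 <= t -> `|k t| <= expR (- (x * t))) ->
    exp_bounded K C f -> K < x ->
  mu.-integrable halfline (EFin \o (fun t => k t * f t)) /\
  `|\int[mu]_(t in halfline) (k t * f t)| <= C / (x - K).
Proof.
move=> mk mf kx fK Kx.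
have xK : 0 < x - K by rewrite subr_gt0.
have [iE vE] := integrable_expN xK.
have kf t : 0 <= t -> `|k t * f t| <= C * expR (- ((x - K) * t)).
  move=> t0; rewrite normrM mulrC.
  apply: (@le_trans _ _ (C * expR (K * t) * expR (- (x * t)))).
    by apply: ler_pM => //; [exact: fK|exact: kx].
  by rewrite -mulrA -expRD -mulNr -mulrDl -mulNr opprB.
have iCE : mu.-integrable halfline
    (EFin \o (fun t => C * expR (- ((x - K) * t)))).
  exact: integrable_mull.
have ikf : mu.-integrable halfline (EFin \o (fun t => k t * f t)).
  apply: (le_integrable _ _ _ iCE) => //.
    by apply/measurable_EFinP; exact: measurable_funM.
  move=> t; rewrite /= in_itv/= andbT => t0.
  rewrite lee_fin; apply: (le_trans (kf _ t0)).
  by rewrite ler_norm.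
split => //.
apply: (le_trans (le_normr_Rintegral _ ikf)) => //.
rewrite -vE -RintegralZl//.
apply: le_Rintegral => //.
- by have /integrable_norm := ikf; apply: eq_integrable.
- by move=> t; rewrite /= in_itv/= andbT => /kf.
Qed.

End DampedIntegrals.

Section HalfLine.
Context {R : realType}.
Notation mu := (@lebesgue_measure R).
Notation halfline := (`[0%R, +oo[%classic : set R).
Implicit Types (f k : R -> R) (a x C K : R).

Lemma within_halflineM f g : {within halfline, continuous f} ->
  {within halfline, continuous g} ->
  {within halfline, continuous (fun t => f t * g t)}.
Proof. by move=> cf cg t; apply: cvgM; [exact: cf|exact: cg]. Qed.

Lemma within_halflineD f g : {within halfline, continuous f} ->
  {within halfline, continuous g} ->
  {within halfline, continuous (fun t => f t + g t)}.
Proof. by move=> cf cg t; apply: cvgD; [exact: cf|exact: cg]. Qed.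

Lemma within_halflineZ c f : {within halfline, continuous f} ->
  {within halfline, continuous (fun t => c * f t)}.
Proof.
by move=> cf; apply: within_halflineM => //; apply: continuous_subspaceT => t;
  exact: cvg_cst.
Qed.

Lemma powR_within_halfline a : 0 <= a ->
  {within halfline, continuous (fun t : R => t `^ a)}.
Proof.
rewrite le_eqVlt => /predU1P[<-|a0].
  rewrite (_ : (fun t : R => t `^ 0) = cst 1); last first.
    by apply/funext => t; rewrite powRr0.
  by apply: continuous_subspaceT => t; exact: cvg_cst.
apply/continuous_within_itvcyP; split.
  move=> t; rewrite in_itv/= andbT => t0.
  apply: differentiable_continuous; apply/derivable1_diffP.
  by apply: derivable_powR; rewrite in_itv/= andbT.
by rewrite powR0 ?gt_eqF//; exact: powR_cvg0.
Qed.

(** From K t / a <= exp(K t / a), raised to the power a. *)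
Lemma exp_bounded_powR K a : 0 < K -> 0 <= a ->
  exists C, exp_bounded K C (fun t => t `^ a).
Proof.
move=> K0; rewrite le_eqVlt => /predU1P[<-|a0].
  exists 1 => t t0; rewrite /= powRr0 normr1 mul1r.
  by apply: (le_trans _ (expR_ge1Dx _)); rewrite lerDl mulr_ge0// ltW.
exists ((a / K) `^ a) => t t0.
have aK : 0 < a / K by rewrite divr_gt0.
rewrite /= ger0_norm ?powR_ge0// (_ : K * t = K * t / a * a); last first.
  by rewrite mulfVK ?gt_eqF.
rewrite expRM -powRM ?expR_ge0//; last exact: ltW.
apply: ge0_ler_powR;
  rewrite ?nnegrE ?mulr_ge0 ?expR_ge0 ?invr_ge0 ?(ltW a0) ?(ltW K0)//.
rewrite mulrC -ler_pdivrMr// invf_div.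
apply: (le_trans _ (expR_ge1Dx _)).
by rewrite [t * _]mulrCA mulrA ler_wpDl.
Qed.

Lemma exp_boundedD K C1 C2 f1 f2 : exp_bounded K C1 f1 -> exp_bounded K C2 f2 ->
  exp_bounded K (C1 + C2) (fun t => f1 t + f2 t).
Proof.
move=> b1 b2 t t0; rewrite mulrDl; apply: (le_trans (ler_normD _ _)).
by apply: lerD; [exact: b1|exact: b2].
Qed.

Lemma exp_boundedZ K C a f : exp_bounded K C f ->
  exp_bounded K (`|a| * C) (fun t => a * f t).
Proof. by move=> b t t0; rewrite normrM -mulrA ler_wpM2l// b. Qed.

Lemma exp_boundedM K L C k f : exp_bounded L 1 k -> exp_bounded K C f ->
  exp_bounded (K + L) C (fun t => k t * f t).
Proof.
move=> bk bf t t0; rewrite normrM mulrC mulrDl expRD mulrA.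
by apply: ler_pM => //; [exact: bf|rewrite -[leRHS]mul1r; exact: bk].
Qed.

Lemma exp_bounded_cvg0 K C f : 0 < K -> exp_bounded (- K) C f ->
  f t @[t --> +oo] --> 0.
Proof.
move=> K0 bf; apply: norm_cvg0.
apply: (@squeeze_cvgr _ _ _ _ (cst 0) (fun t => C * expR (- (K * t)))).
- near=> t; rewrite normr_ge0/= -mulNr; apply: bf.
  by near: t; exact: nbhs_pinfty_ge.
- exact: cvg_cst.
- rewrite -[X in _ --> X](mulr0 C); apply: cvgMl_tmp.
  apply: (@cvg_comp _ _ _ (fun t => K * t) (fun z => expR (- z)) _
    (pinfty_nbhs R)).
    exact: gt0_cvgMry.
  exact: cvgr_expR.
Unshelve. all: by end_near. Qed.

(** Adding C exp(- K t) to [f] makes the integrand nonnegative, which reduces the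
    signed statement to the fundamental theorem of calculus for nonnegative
    functions; the integral of the added term is C / K. *)
Lemma FTC_halfline K C f (F : R -> R) : 0 < K -> exp_bounded (- K) C f ->
    {within halfline, continuous f} ->
    (forall t : R, 0 < t -> is_derive t 1 F (f t)) ->
    F t @[t --> 0^'+] --> F 0 -> F t @[t --> +oo] --> 0 ->
  \int[mu]_(t in halfline) f t = - F 0.
Proof.
move=> K0 bf cf dF F0 Foo.
have [iE vE] := integrable_expN K0.
have if' : mu.-integrable halfline (EFin \o f).
  have := @damped_integrable _ (fun t => expR (- (K * t)))
    (fun t => expR (K * t) * f t) K 0 C.
  case.
  - by have /integrableP[/measurable_EFinP] := iE.
  - apply: measurable_funM; last exact: within_halfline_measurable.
    apply: measurable_funTS; apply: continuous_measurable_fun => t.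
    apply: continuous_comp; last exact: continuous_expR.
    by apply: cvgMl_tmp; exact: cvg_id.
  - by move=> t _; rewrite ger0_norm// expR_ge0.
  - move=> t t0; rewrite mul0r expR0 mulr1 normrM ger0_norm ?expR_ge0//.
    rewrite mulrC -ler_pdivlMr ?expR_gt0// -expRN -mulNr; exact: bf.
  - by [].
  - move=> + _; apply: eq_integrable => // t _ /=.
    by rewrite mulrA -expRD addNr expR0 mul1r.
pose G t := F t - C / K * expR (- (K * t)).
have cE : continuous (fun t : R => expR (- (K * t))).
  move=> t; apply: continuous_comp; last exact: continuous_expR.
  by apply: cvgN; apply: cvgMl_tmp; exact: cvg_id.
have dG (t : R) : 0 < t -> is_derive t 1 G (f t + C * expR (- (K * t))).
  move=> t0; have dFt := dF _ t0.
  apply: is_derive_eq.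
  rewrite /GRing.scale/= !mulr1.
  by field; rewrite gt_eqF.
have GE : \int[mu]_(t in halfline) (f t + C * expR (- (K * t))) = 0 - G 0.
  apply: Rintegral_ge0_continuous_FTC2y.
  - move=> t t0; rewrite addrC -lerBlDr sub0r.
    by apply: (le_trans (ler_norm _)); rewrite normrN -mulNr; exact: bf.
  - apply: within_halflineD => //.
    by apply: within_halflineZ; exact: continuous_subspaceT.
  - rewrite /G -[X in _ --> X]subr0; apply: cvgB => //.
    apply: (@exp_bounded_cvg0 K (`|C / K|)) => // t t0.
    by rewrite normrM mulNr [`|expR _|]ger0_norm ?expR_ge0.
  - by move=> t /dG [].
  - apply: cvgB => //; apply: cvgMl_tmp; apply: cvg_at_right_filter; exact: cE.
  - move=> t; rewrite in_itv/= andbT => t0.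
    by rewrite derive1E; have [_ ->] := dG _ t0.
move: GE; rewrite RintegralD//; last exact: integrable_mull.
rewrite RintegralZl// vE /G mulr0 oppr0 expR0 mulr1.
by move: (C / K) => e h; lra.
Qed.

End HalfLine.

(** * Laplace transform of a power at a complex argument *)

Section OscillatingGammaIntegral.
Context {R : realType}.
Notation mu := (@lebesgue_measure R).
Notation halfline := (`[0%R, +oo[%classic : set R).
Implicit Types (a x y phi t : R).

(** The phase [phi] treats both parts of exp(- (x + i y) t) at once: it is 0 for
    the real part, - pi / 2 for minus the imaginary part, and differentiation
    in y adds pi / 2 to it. *)
Definition osc x y phi t := expR (- (x * t)) * cos (y * t + phi).

Definition osc_integral a x phi y :=
  \int[mu]_(t in halfline) (osc x y phi t * t `^ a).

Lemma norm_osc x y phi t : `|osc x y phi t| <= expR (- (x * t)).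
Proof.
rewrite normrM ger0_norm ?expR_ge0// ler_piMr ?expR_ge0//.
by rewrite ler_norml cos_geN1 cos_le1.
Qed.

Lemma continuous_osc x y phi : continuous (osc x y phi).
Proof.
move=> t; apply: cvgM.
  apply: continuous_comp; last exact: continuous_expR.
  by apply: cvgN; apply: cvgMl_tmp; exact: cvg_id.
apply: continuous_comp; last exact: continuous_cos.
by apply: cvgD; [apply: cvgMl_tmp; exact: cvg_id|exact: cvg_cst].
Qed.

Lemma osc_integrable a x y phi : 0 <= a -> 0 < x ->
  mu.-integrable halfline (EFin \o (fun t => osc x y phi t * t `^ a)).
Proof.
move=> a0 x0.
have x20 : 0 < x / 2 by lra.
have [C bC] := exp_bounded_powR x20 a0.
apply: (@damped_integrable R (osc x y phi) (fun t => t `^ a) x (x / 2) C _ _ _ bC _).1.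
- apply: measurable_funTS; apply: continuous_measurable_fun.
  exact: continuous_osc.
- exact: (within_halfline_measurable (powR_within_halfline a0)).
- by move=> t _; exact: norm_osc.
- by lra.
Qed.

Lemma powRD1 a t : 0 <= a -> 0 <= t -> t `^ (a + 1) = t * t `^ a.
Proof.
move=> a0 t0; rewrite powRD ?powRr1// 1?mulrC//.
by apply/implyP => /eqP ?; exfalso; lra.
Qed.

Lemma is_derive_osc_y x y phi t :
  is_derive y 1 (fun y => osc x y phi t) (t * osc x y (phi + pi / 2) t).
Proof.
rewrite /osc addrA cosDpihalf; apply: is_derive_eq.
by rewrite /GRing.scale/= !(mulr0, addr0, mulr1, add0r); ring.
Qed.

Lemma is_derive_osc_integral a x phi y : 0 <= a -> 0 < x ->
  is_derive y 1 (osc_integral a x phi) (osc_integral (a + 1) x (phi + pi / 2) y).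
Proof.
move=> a0 x0.
have a10 : 0 <= a + 1 by lra.
pose f (y t : R) := osc x y phi t * t `^ a.
have df (z t : R) : is_derive z 1 (f ^~ t)
    (t * osc x z (phi + pi / 2) t * t `^ a).
  have h := is_derive_osc_y x z phi t.
  by apply: is_derive_eq; rewrite /GRing.scale/= mulr0 add0r mulrC.
have dfE (z t : R) : 0 <= t -> partial1of2 f z t =
    osc x z (phi + pi / 2) t * t `^ (a + 1).
  move=> t0; rewrite partial1of2E; have [_ ->] := df z t.
  by rewrite powRD1//; ring.
pose G t := expR (- (x * t)) * `|t `^ (a + 1)|.
have yI : (`]y - 1, y + 1[%classic : set R) y by rewrite /= in_itv/=; lra.
have mh : measurable halfline by [].
have intf z : (`]y - 1, y + 1[%classic : set R) z ->
    mu.-integrable halfline (EFin \o f z).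
  by move=> _; exact: (osc_integrable z phi a0 x0).
have der z t : (`]y - 1, y + 1[%classic : set R) z -> halfline t ->
    derivable (f ^~ t) z 1.
  by move=> _ _; have [] := df z t.
have G0 t : 0 <= G t by rewrite mulr_ge0 ?expR_ge0.
have intG : mu.-integrable halfline (EFin \o G).
  apply: (@eq_integrable _ _ _ mu _ _
    (EFin \o (fun t => osc x 0 0 t * t `^ (a + 1)))) => //.
    move=> t _; rewrite /= /G /osc mul0r addr0 cos0 mulr1.
    by rewrite [`|_|]ger0_norm ?powR_ge0.
  exact: osc_integrable.
have G_ub z t : (`]y - 1, y + 1[%classic : set R) z -> halfline t ->
    `|partial1of2 f z t| <= G t.
  move=> _; rewrite /= in_itv/= andbT => t0; rewrite dfE// normrM.
  by rewrite ler_wpM2r ?norm_osc.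
have E : \int[mu]_(t in halfline) (partial1of2 f ^~ t) y =
    osc_integral (a + 1) x (phi + pi / 2) y.
  by apply: eq_Rintegral => t; rewrite inE/= in_itv/= andbT => t0; exact: dfE.
apply: DeriveDef.
  exact: (@derivable_under_integral _ _ _ mu f _ mh y _ _ yI intf der G G0
    intG G_ub).
rewrite -derive1E.
rewrite (@differentiation_under_integral _ _ _ mu f _ mh y _ _ yI intf der G G0
  intG G_ub).
exact: E.
Qed.

Lemma osc_exp_bounded a x y phi : 0 <= a -> 0 < x ->
  exists C, exp_bounded (- (x / 2)) C (fun t => osc x y phi t * t `^ a).
Proof.
move=> a0 x0.
have x20 : 0 < x / 2 by lra.
have [C bC] := exp_bounded_powR x20 a0.
exists C; rewrite (_ : - (x / 2) = x / 2 + - x); last by lra.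
by apply: exp_boundedM => // t _; rewrite mul1r mulNr norm_osc.
Qed.

Lemma osc_within a x y phi : 0 <= a ->
  {within halfline, continuous (fun t => osc x y phi t * t `^ a)}.
Proof.
move=> a0; apply: within_halflineM; last exact: powR_within_halfline.
exact/continuous_subspaceT/continuous_osc.
Qed.

(** The integral of the derivative of exp(- x t) cos(y t + phi) t^(a + 1), which
    vanishes at 0 and at infinity.  With z = x + i y and I_p the integral of
    t^(p - 1) exp(- z t), this is a component of p I_p = z I_(p+1), for
    p = a + 1. *)
Lemma osc_integral_rec a x phi y : 0 <= a -> 0 < x ->
  (a + 1) * osc_integral a x phi y - x * osc_integral (a + 1) x phi y
  + y * osc_integral (a + 1) x (phi + pi / 2) y = 0.
Proof.
move=> a0 x0.
have a10 : 0 <= a + 1 by lra.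
have x20 : 0 < x / 2 by lra.
have [C1 b1] := osc_exp_bounded y phi a0 x0.
have [C2 b2] := osc_exp_bounded y phi a10 x0.
have [C3 b3] := osc_exp_bounded y (phi + pi / 2) a10 x0.
pose F t := osc x y phi t * t `^ (a + 1).
pose f1 t := (a + 1) * (osc x y phi t * t `^ a).
pose f2 t := (- x) * (osc x y phi t * t `^ (a + 1)).
pose f3 t := y * (osc x y (phi + pi / 2) t * t `^ (a + 1)).
have F0 : F 0 = 0.
  by rewrite /F powR0 ?mulr0//; apply/negP => /eqP ?; lra.
have FTC : \int[mu]_(t in halfline) (f1 t + f2 t + f3 t) = - F 0.
  apply: (@FTC_halfline R (x / 2)
    (`|a + 1| * C1 + `|- x| * C2 + `|y| * C3)) => //.
  - by apply: exp_boundedD; [apply: exp_boundedD|]; exact: exp_boundedZ.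
  - by apply: within_halflineD; first apply: within_halflineD;
      apply: within_halflineZ; exact: osc_within.
  - move=> t t0; have dp := is_derive1_powR (a + 1) t0.
    rewrite /F /osc; apply: is_derive_eq.
    rewrite /GRing.scale/= /f1 /f2 /f3 /osc addrK addrA cosDpihalf.
    by rewrite !(mulr0, addr0, mulr1, add0r); ring.
  - have /continuous_within_itvcyP[_] := @osc_within (a + 1) x y phi a10.
    exact.
  - exact: exp_bounded_cvg0 b2.
move: FTC; rewrite F0 oppr0.
have i1 : mu.-integrable halfline (EFin \o f1).
  by apply: integrable_mull; exact: osc_integrable.
have i2 : mu.-integrable halfline (EFin \o f2).
  by apply: integrable_mull; exact: osc_integrable.
have i3 : mu.-integrable halfline (EFin \o f3).
  by apply: integrable_mull; exact: osc_integrable.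
rewrite RintegralD//; last first.
  by apply: (@eq_integrable _ _ _ mu _ _ ((EFin \o f1) \+ (EFin \o f2))%E) => //;
    exact: integrableD.
rewrite RintegralD// !RintegralZl//; try exact: osc_integrable.
by rewrite mulNr.
Qed.

End OscillatingGammaIntegral.

Section LaplaceOfPower.
Context {R : realType}.
Notation mu := (@lebesgue_measure R).
Notation halfline := (`[0%R, +oo[%classic : set R).
Implicit Types (a p x y phi t : R).

(** The integral is taken over the closed half-line, and coincides with Euler's
    Gamma function for p >= 1, when the integrand is continuous at 0. *)
Definition euler_gamma p : R := \int[mu]_(t in halfline) (expR (- t) * t `^ (p - 1)).

Lemma osc_integral_opp a x y : 0 <= a -> 0 < x ->
  osc_integral a x (- (pi / 2)) y = - osc_integral a x (pi / 2) y.
Proof.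
move=> a0 x0; rewrite -[RHS]mulN1r /osc_integral -RintegralZl//; last first.
  exact: osc_integrable.
apply: eq_Rintegral => t _.
rewrite /osc cosDpihalf (_ : cos (y * t - pi / 2) = sin (y * t)); first by ring.
by rewrite cosD cosN sinN cos_pihalf sin_pihalf; ring.
Qed.

(** The derivatives in y are integrals with exponent a + 1; the two instances of
    [osc_integral_rec] form a linear system in them, of determinant
    x^2 + y^2. *)
Lemma osc_integral_ode a x y : 0 <= a -> 0 < x ->
  let c := osc_integral a x 0 in let s := osc_integral a x (- (pi / 2)) in
  let r2 := x ^+ 2 + y ^+ 2 in
  is_derive y 1 c (- (a + 1) * (y * c y + x * s y) / r2) /\
  is_derive y 1 s ((a + 1) * (x * c y - y * s y) / r2).
Proof.
move=> a0 x0 c s r2.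
have r20 : r2 != 0 by rewrite gt_eqF// ltr_pwDl ?sqr_ge0// exprn_gt0.
have a10 : 0 <= a + 1 by lra.
have dc := is_derive_osc_integral 0 y a0 x0.
have ds := is_derive_osc_integral (- (pi / 2)) y a0 x0.
have := osc_integral_rec 0 y a0 x0.
have := osc_integral_rec (- (pi / 2)) y a0 x0.
rewrite addNr add0r (osc_integral_opp y a10 x0) => e2 e1.
rewrite add0r in dc; rewrite addNr in ds.
move: dc ds e1 e2; rewrite -/c -/s.
move: (osc_integral (a + 1) x (pi / 2) y) (osc_integral (a + 1) x 0 y) => dc ds.
move=> idc ids e1 e2; split.
- rewrite (_ : _ / r2 = dc)//; apply: (mulIf r20); rewrite divfK// /r2.
  have e : x * ((a + 1) * s y - x * - dc + y * ds) = 0 by rewrite e2 mulr0.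
  have e' : y * ((a + 1) * c y - x * ds + y * dc) = 0 by rewrite e1 mulr0.
  move: e e'; rewrite !expr2 => e e'; lra.
- rewrite (_ : _ / r2 = ds)//; apply: (mulIf r20); rewrite divfK// /r2.
  have e : y * ((a + 1) * s y - x * - dc + y * ds) = 0 by rewrite e2 mulr0.
  have e' : x * ((a + 1) * c y - x * ds + y * dc) = 0 by rewrite e1 mulr0.
  move: e e'; rewrite !expr2 => e e'; lra.
Qed.

(** Here A z exp(i th z) is the power (x + i z)^(a + 1), and c - i s is the
    integral of t^a exp(- (x + i z) t).  The conclusions are the real and
    imaginary parts of the fact that their product does not depend on z, as its
    derivative vanishes by [osc_integral_ode]. *)
Lemma osc_integral_pow_const a x y : 0 <= a -> 0 < x ->
  let c := osc_integral a x 0 in let s := osc_integral a x (- (pi / 2)) in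
  let A z := expR ((a + 1) / 2 * ln (x ^+ 2 + z ^+ 2)) in
  let th z := (a + 1) * atan (z / x) in
  A y * (cos (th y) * c y + sin (th y) * s y) = A 0 * c 0 /\
  A y * (sin (th y) * c y - cos (th y) * s y) = 0.
Proof.
move=> a0 x0 c s A th.
have r20 z : 0 < x ^+ 2 + z ^+ 2 by rewrite ltr_pwDl ?sqr_ge0// exprn_gt0.
have x2 : x ^+ 2 != 0 by rewrite expf_neq0// gt_eqF.
have xn0 : x != 0 by rewrite gt_eqF.
have th0 : th 0 = 0 by rewrite /th mul0r atan0 mulr0.
have s0 : s 0 = 0.
  rewrite /s /osc_integral (_ : (fun t => _) = cst 0) ?Rintegral_cst ?mul0r//.
  by apply/funext => t; rewrite /osc mul0r add0r cosN cos_pihalf mulr0 mul0r.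
have dA (z : R) : is_derive z 1 A (A z * ((a + 1) * z / (x ^+ 2 + z ^+ 2))).
  have dl := is_derive1_ln (r20 z).
  apply: is_derive_eq; rewrite /GRing.scale/=.
  rewrite /A; set e := expR _.
  by field; rewrite gt_eqF.
have dth (z : R) : is_derive z 1 th ((a + 1) * (x / (x ^+ 2 + z ^+ 2))).
  rewrite /th; apply: is_derive_eq; rewrite /GRing.scale/=.
  have h : 1 + (z / x) ^+ 2 = (x ^+ 2 + z ^+ 2) / x ^+ 2 by field.
  rewrite h; field.
  by rewrite xn0 gt_eqF.
split.
- pose W z := A z * (cos (th z) * c z + sin (th z) * s z).
  have -> : A y * (cos (th y) * c y + sin (th y) * s y) = W 0.
    apply: (@is_derive_0_is_cst R W y 0) => z.
    have [dc ds] := osc_integral_ode z a0 x0.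
    rewrite /W; apply: is_derive_eq.
    rewrite /GRing.scale/= -/c -/s.
    by field; rewrite gt_eqF.
  by rewrite /W th0 cos0 sin0 mul1r mul0r addr0.
- pose W z := A z * (sin (th z) * c z - cos (th z) * s z).
  have -> : A y * (sin (th y) * c y - cos (th y) * s y) = W 0.
    apply: (@is_derive_0_is_cst R W y 0) => z.
    have [dc ds] := osc_integral_ode z a0 x0.
    rewrite /W; apply: is_derive_eq.
    rewrite /GRing.scale/= -/c -/s.
    by field; rewrite gt_eqF.
  by rewrite /W th0 cos0 sin0 s0 mulr0 mul0r subr0 mulr0.
Qed.

(** The substitution u = x t. *)
Lemma osc_integral_real a x : 0 <= a -> 0 < x ->
  expR ((a + 1) / 2 * ln (x ^+ 2)) * osc_integral a x 0 0 = euler_gamma (a + 1).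
Proof.
move=> a0 x0.
have -> : (a + 1) / 2 * ln (x ^+ 2) = ln x * (a + 1).
  by rewrite lnXn// mulr2n; field.
rewrite expRM lnK ?posrE//.
rewrite powRD1// 1?ltW//.
have intx : mu.-integrable halfline (EFin \o (fun t => osc x 0 0 t * t `^ a)).
  exact: osc_integrable.
rewrite /euler_gamma addrK.
transitivity (\int[mu]_(t in halfline) (expR (- (t * x)) * (t * x) `^ a * x)).
  rewrite /osc_integral -RintegralZl//; apply: eq_Rintegral => t.
  rewrite inE/= in_itv/= andbT => t0.
  rewrite /osc mul0r addr0 cos0 mulr1 powRM// 1?ltW// [x * t]mulrC; ring.
have dF : (fun t : R => t * x)^`()%classic = cst x.
  apply/funext => t; rewrite derive1E.
  have [_ ->] : is_derive t 1 (fun t : R => t * x) x.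
    by apply: is_derive_eq; rewrite /GRing.scale/= mulr0 add0r mulr1.
  by [].
rewrite /Rintegral; congr fine.
rewrite -[in RHS](mul0r x).
rewrite (@increasing_ge0_integration_by_substitutiony R (fun t => t * x)
  (fun t => expR (- t) * t `^ a) 0).
- by apply: eq_integral => t _; rewrite dF.
- by move=> u v _ _ uv; rewrite ltr_pM2r.
- by rewrite dF => t _; exact: cvg_cst.
- by rewrite dF; exact: is_cvg_cst.
- by rewrite dF; exact: is_cvg_cst.
- split; first by move=> t _; exact: ex_derive.
  by apply: cvg_at_right_filter; apply: cvgMr_tmp; exact: cvg_id.
- exact: gt0_cvgMly.
- rewrite mul0r (_ : (fun t => _) = (fun t => osc 1 0 0 t * t `^ a)).
    exact: osc_within.
  by apply/funext => t; rewrite /osc mul1r mul0r addr0 cos0 mulr1.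
- by move=> t _; rewrite mulr_ge0 ?expR_ge0 ?powR_ge0.
Qed.

End LaplaceOfPower.

(** * Principal power in the right half-plane *)

Section ComplexPower.
Context {R : realType}.
Implicit Types (x y p : R) (z w : R[i]).

Lemma complex_eqP z w : complex.Re z = complex.Re w ->
  complex.Im z = complex.Im w -> z = w.
Proof. by case: z w => [? ?] [? ?] /= -> ->. Qed.

Lemma Re_norm z : complex.Re `|z| = normc z.
Proof. by rewrite normc_def; case: z. Qed.

Lemma normc_ge0 z : 0 <= normc z.
Proof. by case: z => a b; exact: sqrtr_ge0. Qed.

Lemma normcX z n : normc (z ^+ n) = normc z ^+ n.
Proof. by elim: n => [|n IHn]; rewrite ?expr0 ?normc1// !exprS normcM IHn. Qed.

Lemma cexpD z w : cexp (z + w) = cexp z * cexp w.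
Proof.
case: z w => [a b] [c d]; rewrite /cexp /= expRD cosD sinD.
by apply: complex_eqP => /=; ring.
Qed.

Lemma normc_gt0 x y : 0 < x -> 0 < normc (x +i* y).
Proof. by move=> x0; rewrite /= sqrtr_gt0 ltr_pwDl ?sqr_ge0// exprn_gt0. Qed.

Lemma normc_cos_atan x y : 0 < x -> normc (x +i* y) * cos (atan (y / x)) = x.
Proof.
move=> x0; rewrite cos_atan /=.
have xn0 : x != 0 by rewrite gt_eqF.
have -> : x ^+ 2 + y ^+ 2 = x ^+ 2 * (1 + (y / x) ^+ 2) by field.
rewrite sqrtrM ?sqr_ge0// sqrtr_sqr gtr0_norm// mulfK// gt_eqF// sqrtr_gt0.
by rewrite ltr_pwDl ?sqr_ge0.
Qed.

Lemma normc_sin_atan x y : 0 < x -> normc (x +i* y) * sin (atan (y / x)) = y.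
Proof.
move=> x0.
have cn0 : cos (atan (y / x)) != 0.
  by apply/eqP => c0; have := normc_cos_atan y x0; rewrite c0 mulr0; lra.
have -> : sin (atan (y / x)) = y / x * cos (atan (y / x)).
  by rewrite -{2}[y / x]atanK /tan divfK.
by rewrite mulrCA normc_cos_atan// divfK// gt_eqF.
Qed.

Lemma carg_atan x y : 0 < x -> carg (x +i* y) = atan (y / x).
Proof.
move=> x0; rewrite /carg Re_norm [complex.Re _]/= [complex.Im _]/=.
have -> : x / normc (x +i* y) = cos (atan (y / x)).
  rewrite -{1}(normc_cos_atan y x0) mulrAC divff ?mul1r//.
  by rewrite gt_eqF// normc_gt0.
have := atan_gtNpi2 (y / x); have := atan_ltpi2 (y / x).
have pi0 := pi_gt0 R.
have [y0|y0] := leP 0 y => u l.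
  rewrite cosK// in_itv/=.
  have : 0 <= atan (y / x) by rewrite -[leLHS]atan0 le_atan// divr_ge0// ltW.
  by move=> h; apply/andP; split => //; lra.
rewrite cosKN ?opprK//.
have : atan (y / x) <= 0.
  by rewrite -[leRHS]atan0 le_atan// ltW// pmulr_llt0// invr_gt0.
by move=> h; apply/andP; split => //; lra.
Qed.

Lemma clog_right x y : 0 < x ->
  clog (x +i* y) = (2^-1 * ln (x ^+ 2 + y ^+ 2)) +i* atan (y / x).
Proof.
move=> x0; rewrite /clog carg_atan// Re_norm; congr (_ +i* _).
have r20 : 0 < x ^+ 2 + y ^+ 2 by rewrite ltr_pwDl ?sqr_ge0// exprn_gt0.
by rewrite /= -powR12_sqrt ?ltW// ln_powR.
Qed.

Lemma cexp_clog x y : 0 < x -> cexp (clog (x +i* y)) = x +i* y.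
Proof.
move=> x0; rewrite /clog carg_atan// /cexp Re_norm.
rewrite [complex.Re _]/= [complex.Im _]/= lnK ?posrE ?normc_gt0//.
by rewrite normc_cos_atan// normc_sin_atan.
Qed.

Lemma right_neq0 x y : 0 < x -> x +i* y != 0.
Proof. by move=> x0; rewrite eq_complex/= gt_eqF. Qed.

(** The form of the power that occurs in [osc_integral_pow_const]: for a positive
    real part the principal argument is an arctangent, hence differentiable in
    the imaginary part. *)
Lemma cpow_polar x y p : 0 < x -> cpow (x +i* y) p%:C =
  expR (p / 2 * ln (x ^+ 2 + y ^+ 2)) *
    cos (p * atan (y / x)) +i*
  (expR (p / 2 * ln (x ^+ 2 + y ^+ 2)) * sin (p * atan (y / x))).
Proof.
move=> x0; rewrite /cpow (negbTE (right_neq0 y x0)) clog_right// /cexp.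
by rewrite /= !mul0r addr0 subr0 mulrA.
Qed.

Lemma cpowD z v w : z != 0 -> cpow z (v + w) = cpow z v * cpow z w.
Proof. by move=> /negbTE z0; rewrite /cpow z0 mulrDl cexpD. Qed.

Lemma cpow_natr x y w n : 0 < x ->
  cpow (x +i* y) (w * n%:R) = cpow (x +i* y) w ^+ n.
Proof.
move=> x0; have zn0 := right_neq0 y x0; elim: n => [|n IHn].
  rewrite mulr0 expr0 /cpow (negbTE zn0) mul0r /cexp /= expR0 cos0 sin0.
  by rewrite mulr1 mulr0.
by rewrite -natr1 mulrDr mulr1 cpowD// IHn exprSr.
Qed.

Lemma cpow_nat x y n : 0 < x -> cpow (x +i* y) n%:R = (x +i* y) ^+ n.
Proof.
move=> x0; rewrite -[n%:R]mul1r cpow_natr//.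
by rewrite {1}/cpow (negbTE (right_neq0 y x0)) mul1r cexp_clog.
Qed.

Lemma normc_cpow_ge x y p : 0 < x -> 0 <= p ->
  x `^ p <= normc (cpow (x +i* y) p%:C).
Proof.
move=> x0 p0; rewrite cpow_polar// /=; set e := expR _.
have -> : (e * cos (p * atan (y / x))) ^+ 2 + (e * sin (p * atan (y / x))) ^+ 2
    = e ^+ 2.
  by rewrite !exprMn -mulrDr cos2Dsin2 mulr1.
rewrite sqrtr_sqr ger0_norm ?expR_ge0// /e /powR gt_eqF// ler_expR.
rewrite -mulrA ler_wpM2l//.
have -> : ln x = 2^-1 * ln (x ^+ 2) by rewrite lnXn// mulr2n; field.
rewrite ler_wpM2l ?invr_ge0// ler_ln ?posrE ?exprn_gt0//.
  by rewrite lerDl sqr_ge0.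
by rewrite ltr_pwDl ?sqr_ge0// exprn_gt0.
Qed.

Lemma ge_Re_normc x y : x <= normc (x +i* y).
Proof.
apply: (le_trans (ler_norm _)); rewrite -sqrtr_sqr /= ler_wsqrtr//.
by rewrite lerDl sqr_ge0.
Qed.

End ComplexPower.

(** * The Gamma integral *)

Section LaplacePower.
Context {R : realType}.
Notation mu := (@lebesgue_measure R).
Notation halfline := (`[0%R, +oo[%classic : set R).
Implicit Types (f : R -> R) (a p x y t : R).

Lemma laplace_real f x y : laplace (fun t => (f t)%:C) (x +i* y) =
  \int[mu]_(t in halfline) (osc x y 0 t * f t) +i*
  \int[mu]_(t in halfline) (- osc x y (- (pi / 2)) t * f t).
Proof.
rewrite /laplace /cintegral; congr (_ +i* _); apply: eq_Rintegral => t _.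
  rewrite /laplace_integrand /cexp /osc /= !mulr0 !subr0 addr0.
  by rewrite add0r cosN.
rewrite /laplace_integrand /cexp /osc /= !mulr0 !subr0 !add0r.
rewrite sinN (_ : cos (y * t - pi / 2) = sin (y * t)).
  by rewrite mulrN.
by rewrite cosD cosN sinN cos_pihalf sin_pihalf; ring.
Qed.

(** Both components of [osc_integral_pow_const], whose right-hand sides are
    Gamma(a + 1) and 0 by [osc_integral_real]. *)
Lemma laplace_power a x y : 0 <= a -> 0 < x ->
  laplace (fun t => (t `^ a)%:C) (x +i* y) =
  (euler_gamma (a + 1))%:C / cpow (x +i* y) (a + 1)%:C.
Proof.
move=> a0 x0; rewrite laplace_real.
have a10 : 0 <= a + 1 by lra.
have pn0 : cpow (x +i* y) (a + 1)%:C != 0.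
  apply/eqP => c0; have := normc_cpow_ge y x0 a10.
  by rewrite c0 normc0; apply/negP; rewrite -ltNge powR_gt0.
apply: (mulIf pn0); rewrite divfK// cpow_polar//.
have [] := osc_integral_pow_const y a0 x0; cbv zeta.
rewrite expr0n/= addr0 osc_integral_real//.
have -> : \int[mu]_(t in halfline) (- osc x y (- (pi / 2)) t * t `^ a) =
    - osc_integral a x (- (pi / 2)) y.
  rewrite -[RHS]mulN1r -RintegralZl//; last exact: osc_integrable.
  by apply: eq_Rintegral => t _; ring.
rewrite -/(osc_integral a x 0 y).
move: (osc_integral _ _ _ _) (osc_integral _ _ _ _) => c s.
move: (expR _) (cos _) (sin _) (euler_gamma _) => A ct st g e1 e2.
apply: complex_eqP => /=.
- by rewrite -e1; ring.
- by rewrite -e2; ring.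
Qed.

Lemma cGamma_real p : 1 <= p -> cGamma p%:C = (euler_gamma p)%:C.
Proof.
move=> p1; rewrite /cGamma /cintegral.
have p10 : 0 <= p - 1 by lra.
have i1 : mu.-integrable halfline (EFin \o (fun t => expR (- t) * t `^ (p - 1))).
  have := @osc_integrable R (p - 1) 1 0 0 p10 ltr01.
  apply: eq_integrable => // t _.
  by rewrite /= /osc mul1r mul0r addr0 cos0 mulr1.
have E t : 0 < t -> cpow t%:C (p%:C - 1) * (expR (- t))%:C =
    (expR (- t) * t `^ (p - 1))%:C.
  move=> t0; have -> : p%:C - 1 = (p - 1)%:C :> R[i] by rewrite rmorphB.
  rewrite cpow_polar// mul0r atan0 mulr0 cos0 sin0 mulr0 mulr1.
  rewrite expr0n/= addr0 lnXn// /powR gt_eqF//.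
  have -> : (p - 1) / 2 * (ln t *+ 2) = (p - 1) * ln t by rewrite mulr2n; field.
  by apply: complex_eqP => /=; ring.
apply: complex_eqP => /=.
- rewrite /euler_gamma -Rintegral_itv_obnd_cbnd; last first.
    by apply: integrableS i1 => //; apply: subset_itvr; rewrite bnd_simp.
  apply: eq_Rintegral => t; rewrite inE/= in_itv/= andbT => t0.
  by rewrite E.
- rewrite (@eq_Rintegral _ _ _ mu _ (cst 0)) ?Rintegral_cst ?mul0r// => t.
  by rewrite inE/= in_itv/= andbT => t0; rewrite E.
Qed.

(** Restriction of the integral to [T, T + 1].  The parameter T is free: choosing
    it proportional to t turns a series over Gamma values into a geometric
    one. *)
Lemma euler_gamma_ge p T : 1 <= p -> 0 < T ->
  expR (- (T + 1)) * T `^ (p - 1) <= euler_gamma p.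
Proof.
move=> p1 T0.
have p10 : 0 <= p - 1 by lra.
have i1 : mu.-integrable halfline (EFin \o (fun t => expR (- t) * t `^ (p - 1))).
  have := @osc_integrable R (p - 1) 1 0 0 p10 ltr01.
  apply: eq_integrable => // t _.
  by rewrite /= /osc mul1r mul0r addr0 cos0 mulr1.
have sub : `[T, T + 1] `<=` halfline.
  by move=> t; rewrite /= !in_itv/= => /andP[Tt _]; rewrite (le_trans _ Tt)// ltW.
have i2 : mu.-integrable `[T, T + 1]
    (EFin \o (fun t => expR (- t) * t `^ (p - 1))).
  exact: integrableS i1.
have cstE c : \int[mu]_(t in `[T, T + 1]) c = c.
  rewrite Rintegral_cst//= lebesgue_measure_itv/= lte_fin ltrDl ltr01 -EFinB.
  by rewrite addrAC subrr add0r mulr1.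
have le1 : \int[mu]_(t in `[T, T + 1]) (expR (- t) * t `^ (p - 1)) <=
    euler_gamma p.
  rewrite /euler_gamma /Rintegral fine_le ?integrable_fin_num//.
  apply: ge0_subset_integral => //.
    by have /integrableP[] := i1.
  by move=> t _; rewrite lee_fin mulr_ge0 ?expR_ge0 ?powR_ge0.
apply: le_trans le1.
rewrite -[leLHS]cstE.
apply: le_Rintegral => //.
  apply: continuous_compact_integrable; first exact: segment_compact.
  by apply: continuous_subspaceT => t; exact: cvg_cst.
move=> t; rewrite /= in_itv/= => /andP[Tt tT].
apply: ler_pM; rewrite ?expR_ge0 ?powR_ge0// ?ler_expR ?lerN2//.
by apply: ge0_ler_powR => //; rewrite nnegrE// ?(ltW T0) ?(le_trans (ltW T0)).
Qed.

Lemma euler_gamma_gt0 p : 1 <= p -> 0 < euler_gamma p.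
Proof.
move=> p1; apply: (lt_le_trans _ (euler_gamma_ge p1 (@ltr01 R))).
by rewrite mulr_gt0 ?expR_gt0 ?powR_gt0.
Qed.

End LaplacePower.

(** * Linearity of the transform, and series dominated by a geometric one *)

Section ExponentialOrder.
Context {R : realType}.
Notation mu := (@lebesgue_measure R).
Notation halfline := (`[0%R, +oo[%classic : set R).
Implicit Types (f g : R -> R) (K x y t : R).

Definition exp_order K f :=
  {within halfline, continuous f} /\ exists C, exp_bounded K C f.

Lemma exp_orderD K f g : exp_order K f -> exp_order K g ->
  exp_order K (fun t => f t + g t).
Proof.
move=> [cf [C bf]] [cg [D bg]]; split; first exact: within_halflineD.
by exists (C + D); exact: exp_boundedD.
Qed.

Lemma exp_orderZ K c f : exp_order K f -> exp_order K (fun t => c * f t).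
Proof.
move=> [cf [C bf]]; split; last by exists (`|c| * C); exact: exp_boundedZ.
exact: within_halflineZ.
Qed.

Lemma exp_order0 K : exp_order K (fun=> 0).
Proof.
split; first by apply: continuous_subspaceT => t; exact: cvg_cst.
by exists 0 => t _; rewrite normr0 mul0r.
Qed.

Lemma exp_order_sum K (u : nat -> R -> R) N :
  (forall n, exp_order K (u n)) -> exp_order K (fun t => \sum_(n < N) u n t).
Proof.
move=> hu; elim: N => [|N IHN].
  rewrite (_ : (fun t => _) = fun=> 0); first exact: exp_order0.
  by apply/funext => t; rewrite big_ord0.
rewrite (_ : (fun t => _) = fun t => \sum_(n < N) u n t + u N t).
  exact: exp_orderD.
by apply/funext => t; rewrite big_ord_recr.
Qed.

Lemma osc_exp_order K C f x y phi : {within halfline, continuous f} ->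
    exp_bounded K C f -> K < x ->
  mu.-integrable halfline (EFin \o (fun t => osc x y phi t * f t)) /\
  `|\int[mu]_(t in halfline) (osc x y phi t * f t)| <= C / (x - K).
Proof.
move=> cf bf Kx; apply: (damped_integrable _ _ _ bf Kx).
- by apply: measurable_funTS; apply: continuous_measurable_fun; exact: continuous_osc.
- exact: within_halfline_measurable.
- by move=> t _; exact: norm_osc.
Qed.

Lemma osc_exp_order_integrable K f x y phi : exp_order K f -> K < x ->
  mu.-integrable halfline (EFin \o (fun t => osc x y phi t * f t)).
Proof. by move=> [cf [C bf]] /(osc_exp_order y phi cf bf)[]. Qed.

Lemma laplace_exp_order K f x y : exp_order K f -> K < x ->
  laplace (fun t => (f t)%:C) (x +i* y) =
  \int[mu]_(t in halfline) (osc x y 0 t * f t) -i*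
  \int[mu]_(t in halfline) (osc x y (- (pi / 2)) t * f t).
Proof.
move=> hf Kx; rewrite laplace_real; congr (_ +i* _).
rewrite -[RHS]mulN1r -RintegralZl//; last exact: osc_exp_order_integrable hf Kx.
by apply: eq_Rintegral => t _; rewrite mulN1r mulNr.
Qed.

Lemma laplaceD K f g x y : exp_order K f -> exp_order K g -> K < x ->
  laplace (fun t => (f t + g t)%:C) (x +i* y) =
  laplace (fun t => (f t)%:C) (x +i* y) + laplace (fun t => (g t)%:C) (x +i* y).
Proof.
move=> hf hg Kx; rewrite !(@laplace_exp_order K)//; last exact: exp_orderD.
have E phi : \int[mu]_(t in halfline) (osc x y phi t * (f t + g t)) =
    \int[mu]_(t in halfline) (osc x y phi t * f t) +
    \int[mu]_(t in halfline) (osc x y phi t * g t).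
  rewrite -RintegralD//; try exact: (@osc_exp_order_integrable K).
  by apply: eq_Rintegral => t _; rewrite mulrDr.
by apply: complex_eqP; rewrite /= E//= opprD.
Qed.

Lemma laplaceZ K c f x y : exp_order K f -> K < x ->
  laplace (fun t => (c * f t)%:C) (x +i* y) =
  c%:C * laplace (fun t => (f t)%:C) (x +i* y).
Proof.
move=> hf Kx; rewrite !(@laplace_exp_order K)//; last exact: exp_orderZ.
have E phi : \int[mu]_(t in halfline) (osc x y phi t * (c * f t)) =
    c * \int[mu]_(t in halfline) (osc x y phi t * f t).
  rewrite -RintegralZl//; try exact: (@osc_exp_order_integrable K).
  by apply: eq_Rintegral => t _; rewrite mulrCA.
by apply: complex_eqP; rewrite /= E//= mul0r ?subr0 ?addr0 ?mulrN.
Qed.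

Lemma laplace_sum K (u : nat -> R -> R) N x y :
    (forall n, exp_order K (u n)) -> K < x ->
  laplace (fun t => (\sum_(n < N) u n t)%:C) (x +i* y) =
  \sum_(n < N) laplace (fun t => (u n t)%:C) (x +i* y).
Proof.
move=> hu Kx; elim: N => [|N IHN].
  rewrite big_ord0 (_ : (fun t => _) = fun t => (0 * (0 : R))%:C).
    by rewrite (laplaceZ _ _ (exp_order0 K))// mul0r.
  by apply/funext => t; rewrite big_ord0 mul0r.
rewrite big_ord_recr/= -IHN -(@laplaceD K)//; last exact: exp_order_sum.
by congr laplace; apply/funext => t; rewrite big_ord_recr.
Qed.

Lemma normc_le_add (a b : R) : normc (a +i* b) <= `|a| + `|b|.
Proof.
rewrite -[leRHS]ger0_norm ?addr_ge0// -sqrtr_sqr /= ler_wsqrtr// sqrrD.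
by rewrite !real_normK ?num_real// addrAC lerDl mulrn_wge0// mulr_ge0.
Qed.

Lemma normc_laplace_le K C f x y : {within halfline, continuous f} ->
    exp_bounded K C f -> K < x ->
  normc (laplace (fun t => (f t)%:C) (x +i* y)) <= 2 * (C / (x - K)).
Proof.
move=> cf bf Kx; rewrite (@laplace_exp_order K)//; last by split => //; exists C.
apply: (le_trans (normc_le_add _ _)); rewrite normrN mulr_natl mulr2n.
by apply: lerD; exact: (osc_exp_order y _ cf bf Kx).2.
Qed.

End ExponentialOrder.

Section GeometricSeries.
Context {R : realType}.
Notation mu := (@lebesgue_measure R).
Notation halfline := (`[0%R, +oo[%classic : set R).
Variables (u : nat -> R -> R) (K C q : R).
Hypothesis q0 : 0 <= q.
Hypothesis q1 : q < 1.
Hypothesis cu : forall n, {within halfline, continuous (u n)}.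
Hypothesis bu : forall n, exp_bounded K (C * q ^+ n) (u n).

Definition series_sum t := limn (series (u^~ t)).

Let C0 : 0 <= C.
Proof.
have := bu 0 (lexx 0); rewrite mulr0 expR0 !mulr1 => h.
exact: le_trans h.
Qed.

Let q1p : 0 < 1 - q. Proof. by rewrite subr_gt0. Qed.

Lemma series_sum_cvg t : 0 <= t -> series (u^~ t) @ \oo --> series_sum t.
Proof.
move=> t0; apply: normed_cvg.
apply: (@series_le_cvg _ _ (geometric (C * expR (K * t)) q)).
- by move=> n /=.
- by move=> n /=; rewrite !mulr_ge0 ?expR_ge0 ?exprn_ge0.
- by move=> n /=; rewrite mulrAC; exact: bu.
- by apply: is_cvg_geometric_series; rewrite ger0_norm.
Qed.

(** The tail of the dominating geometric series.  All that follows about the sum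
    comes from this estimate, since it is uniform up to the factor exp(K t). *)
Lemma series_sum_tail N :
  exp_bounded K (C / (1 - q) * q ^+ N) (fun t => series_sum t - \sum_(n < N) u n t).
Proof.
move=> t t0.
have cvgS := series_sum_cvg t0.
have B M : (N <= M)%N -> `|series (u^~ t) M - \sum_(n < N) u n t| <=
    C / (1 - q) * q ^+ N * expR (K * t).
  move=> /subnKC <-; move: (M - N)%N => j.
  apply: (@le_trans _ _ (C / (1 - q) * (q ^+ N - q ^+ (N + j)) * expR (K * t))).
    rewrite /series/= big_mkord; elim: j => [|j IHj].
      by rewrite addn0 !subrr normr0 mulr0 mul0r.
    rewrite addnS big_ord_recr/= addrAC.
    apply: (le_trans (ler_normD _ _)).
    rewrite (_ : C / (1 - q) * _ * _ =
      C / (1 - q) * (q ^+ N - q ^+ (N + j)) * expR (K * t) +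
      C * q ^+ (N + j) * expR (K * t)); last first.
      by rewrite exprS; field; rewrite gt_eqF.
    by apply: lerD => //; exact: bu.
  rewrite ler_wpM2r ?expR_ge0// ler_wpM2l ?divr_ge0// ?(ltW q1p)//.
  by rewrite gerBl exprn_ge0.
have cn : (fun M => `|series (u^~ t) M - \sum_(n < N) u n t|) @ \oo -->
    `|series_sum t - \sum_(n < N) u n t|.
  by apply: cvg_norm; apply: cvgB => //; exact: cvg_cst.
rewrite -(cvg_lim _ cn)//; apply: limr_le; first by apply/cvg_ex; eexists; exact: cn.
by near=> M; apply: B; near: M; exact: nbhs_infty_ge.
Unshelve. all: by end_near. Qed.

Lemma series_sum_bounded : exp_bounded K (C / (1 - q)) series_sum.
Proof.
move=> t t0; have := series_sum_tail 0 t0.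
by rewrite big_ord0 subr0 expr0 mulr1.
Qed.

Lemma series_sum_within : {within halfline, continuous series_sum}.
Proof.
apply/subspace_continuousP => t th.
have t0 : 0 <= t by move: th; rewrite /= in_itv/= andbT.
apply/cvgrPdist_lt => e e0.
(* The factor exp(K s) is bounded by M for s <= t + 1, so the tail is uniformly
   small near t. *)
pose M := expR (`|K| * (t + 1)).
have M0 : 0 < M by exact: expR_gt0.
have : (fun N => C / (1 - q) * M * q ^+ N) @ \oo --> 0.
  by apply: (@cvg_geometric R (C / (1 - q) * M) q); rewrite ger0_norm.
move=> /cvgrPdist_lt /(_ (e / 3)) [|N _ hN]; first by lra.
have {}hN : C / (1 - q) * M * q ^+ N < e / 3.
  have := hN N (leqnn N); rewrite /= sub0r normrN ger0_norm//.
  by rewrite !mulr_ge0 ?invr_ge0 ?(ltW q1p) ?(ltW M0) ?exprn_ge0.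
have tailM s : 0 <= s -> s <= t + 1 ->
    `|series_sum s - \sum_(n < N) u n s| < e / 3.
  move=> s0 st; apply: le_lt_trans (series_sum_tail N s0) _.
  apply: le_lt_trans hN; rewrite [leRHS]mulrAC ler_wpM2l//.
    by rewrite !mulr_ge0 ?invr_ge0 ?(ltW q1p) ?exprn_ge0.
  rewrite ler_expR; apply: (@le_trans _ _ (`|K| * s)).
    by rewrite ler_wpM2r// ler_norm.
  by rewrite ler_wpM2l.
have cS : {within halfline, continuous (fun t => \sum_(n < N) u n t)}.
  have [] // := @exp_order_sum R K u N.
  by move=> n; split => //; exists (C * q ^+ n).
move/subspace_continuousP : cS => /(_ t th) /cvgrPdist_lt /(_ (e / 3)).
move=> /(_ ltac:(lra)) near_S.
near=> s.
have s0 : 0 <= s.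
  have : halfline s by near: s; exact: withinT.
  by rewrite /= in_itv/= andbT.
have st : s <= t + 1.
  have : `|t - s| < 1.
    by near: s; apply: cvg_within; exact: (nbhsx_ballx t 1 ltr01).
  by rewrite ltr_norml => /andP[? ?]; lra.
have h1 := tailM _ t0 ltac:(lra).
have h2 := tailM _ s0 st.
have h3 : `|\sum_(n < N) u n t - \sum_(n < N) u n s| < e / 3 by near: s.
rewrite (_ : series_sum t - series_sum s =
  (series_sum t - \sum_(n < N) u n t) +
  (\sum_(n < N) u n t - \sum_(n < N) u n s) -
  (series_sum s - \sum_(n < N) u n s)); last by ring.
apply: (le_lt_trans (ler_normB _ _)).
apply: (@le_lt_trans _ _ (`|series_sum t - \sum_(n < N) u n t| +
  `|\sum_(n < N) u n t - \sum_(n < N) u n s| +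
  `|series_sum s - \sum_(n < N) u n s|)).
  by rewrite lerD2r ler_normD.
lra.
Unshelve. all: by end_near. Qed.

Let hu n : exp_order K (u n).
Proof. by split => //; exists (C * q ^+ n). Qed.

Lemma series_sum_exp_order : exp_order K series_sum.
Proof.
by split; [exact: series_sum_within|exists (C / (1 - q)); exact: series_sum_bounded].
Qed.

Lemma laplace_series_tail N x y : K < x ->
  normc (laplace (fun t => (series_sum t)%:C) (x +i* y) -
         \sum_(n < N) laplace (fun t => (u n t)%:C) (x +i* y))
  <= 2 * (C / (1 - q) / (x - K)) * q ^+ N.
Proof.
move=> Kx.
rewrite -(laplace_sum N y hu Kx) -mulN1r.
have -> : -1 * laplace (fun t => (\sum_(n < N) u n t)%:C) (x +i* y) =
    laplace (fun t => (-1 * \sum_(n < N) u n t)%:C) (x +i* y).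
  rewrite (laplaceZ (-1) y (exp_order_sum N hu) Kx); congr (_ * _).
  by apply: complex_eqP => //=; rewrite oppr0.
rewrite -(laplaceD y series_sum_exp_order (exp_orderZ (-1) (exp_order_sum N hu)) Kx).
have -> : 2 * (C / (1 - q) / (x - K)) * q ^+ N =
    2 * (C / (1 - q) * q ^+ N / (x - K)) by rewrite -mulrA [_ / _ * q ^+ N]mulrAC.
apply: normc_laplace_le => //.
  exact: (exp_orderD series_sum_exp_order (exp_orderZ (-1) (exp_order_sum N hu))).1.
by move=> t t0; rewrite mulN1r; exact: series_sum_tail.
Qed.

(** With S_N the partial sums of the transforms and V the transform of the sum,
    (1 - r) S_N = w (1 - r^N), so (1 - r) V - w = (1 - r) (V - S_N) - w r^N, and
    both terms tend to 0. *)
Lemma laplace_geometric_series x y (w r : R[i]) : K < x -> normc r < 1 ->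
    (forall n, laplace (fun t => (u n t)%:C) (x +i* y) = w * r ^+ n) ->
  laplace (fun t => (series_sum t)%:C) (x +i* y) = w / (1 - r).
Proof.
move=> Kx r1 Lu; set V := laplace _ _.
have rn1 : 1 - r != 0.
  by apply/eqP => /subr0_eq e; move: r1; rewrite -e normc1 ltxx.
apply: (mulIf rn1); rewrite divfK//.
apply/eqP; rewrite -subr_eq0; apply/eqP/eq0_normc.
apply/eqP; rewrite eq_le; apply/andP; split; last exact: normc_ge0.
pose a := normc (1 - r) * (2 * (C / (1 - q) / (x - K))).
have E N : normc (V * (1 - r) - w) <= a * q ^+ N + normc w * normc r ^+ N.
  have S : \sum_(n < N) laplace (fun t => (u n t)%:C) (x +i* y) * (1 - r) =
      w - w * r ^+ N.
    elim: N => [|N IHN]; first by rewrite big_ord0 expr0 mulr1 subrr.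
    by rewrite big_ord_recr/= IHN Lu exprS; ring.
  have -> : V * (1 - r) - w =
      (1 - r) * (V - \sum_(n < N) laplace (fun t => (u n t)%:C) (x +i* y)) +
      - (w * r ^+ N).
    move: S; rewrite -mulr_suml; move: (\sum_(n < N) _) => s hs.
    rewrite [(1 - r) * _]mulrC [(V - s) * _]mulrBl hs; ring.
  apply: (le_trans (le_normcD _ _)); apply: lerD.
    rewrite normcM -mulrA ler_wpM2l//; last exact: laplace_series_tail.
    exact: normc_ge0.
  by rewrite normcN normcM normcX.
have nr0 := normc_ge0 r.
have cv : (fun N => a * q ^+ N + normc w * normc r ^+ N) @ \oo --> (0 + 0 : R).
  apply: cvgD.
    by apply: (@cvg_geometric R a q); rewrite ger0_norm.
  by apply: (@cvg_geometric R (normc w) (normc r)); rewrite ger0_norm.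
rewrite -[leRHS]addr0 -(cvg_lim _ cv)//; apply: limr_ge.
  by apply/cvg_ex; eexists; exact: cv.
by apply: nearW.
Qed.

End GeometricSeries.

(** * The double series of Mittag-Leffler type *)

Section LaplaceTransforms.
Context {R : realType}.
Notation mu := (@lebesgue_measure R).
Notation halfline := (`[0%R, +oo[%classic : set R).
Implicit Types (f : R -> R) (x y t K : R).

Lemma euler_gamma1 : euler_gamma 1 = 1 :> R.
Proof.
have [_ /= e] := @integrable_expN R 1 ltr01; rewrite invr1 in e.
rewrite -[RHS]e; apply: eq_Rintegral => t _.
by rewrite subrr powRr0 mulr1 mul1r.
Qed.

Lemma laplace_cst1 x y : 0 < x -> laplace (fun=> 1) (x +i* y) = (x +i* y)^-1.
Proof.
move=> x0; have := @laplace_power R 0 x y (lexx 0) x0.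
rewrite add0r euler_gamma1 (cpow_nat y 1 x0) expr1 div1r => <-.
by congr laplace; apply/funext => t; rewrite powRr0.
Qed.

Lemma laplace_shift f nu x y :
  laplace (fun t => (expR (- (nu * t)) * f t)%:C) (x +i* y) =
  laplace (fun t => (f t)%:C) ((nu + x) +i* y).
Proof.
have E phi t : osc x y phi t * (expR (- (nu * t)) * f t) =
    osc (nu + x) y phi t * f t.
  by rewrite /osc mulrDl opprD expRD; ring.
rewrite !laplace_real; congr (_ +i* _); apply: eq_Rintegral => t _.
  by rewrite E.
by rewrite !mulNr E.
Qed.

Lemma exp_order_cst1 K : 0 <= K -> exp_order K (fun=> 1).
Proof.
move=> K0; split; first by apply: continuous_subspaceT => t; exact: cvg_cst.
exists 1 => t t0; rewrite mul1r normr1.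
by apply: (le_trans _ (expR_ge1Dx _)); rewrite lerDl mulr_ge0.
Qed.

Lemma exp_order_expN K nu f : 0 <= nu -> exp_order K f ->
  exp_order K (fun t => expR (- (nu * t)) * f t).
Proof.
move=> nu0 [cf [C bf]]; split.
  apply: within_halflineM => //; apply: continuous_subspaceT => t.
  apply: continuous_comp; last exact: continuous_expR.
  by apply: cvgN; apply: cvgMl_tmp; exact: cvg_id.
exists C; rewrite -[K]addr0; apply: exp_boundedM => // t t0.
by rewrite mul1r mul0r expR0 ger0_norm ?expR_ge0// expR_le1 oppr_le0 mulr_ge0.
Qed.

End LaplaceTransforms.

(** In this section K is a rate of exponential growth for which both geometric
    ratios |c| / K^beta and nu / K are smaller than 1. *)
Section MittagLefflerDoubleSeries.
Context {R : realType}.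
Notation mu := (@lebesgue_measure R).
Notation halfline := (`[0%R, +oo[%classic : set R).
Variables (beta c nu K : R).
Hypothesis beta0 : 0 < beta.
Hypothesis nu0 : 0 < nu.
Hypothesis nuK : nu < K.
Hypothesis cK : `|c| < K `^ beta.
Implicit Types (m n : nat) (t x y : R).

Definition ml_exponent m n : R := beta * n%:R + m%:R.

Definition ml_term m n t : R :=
  (c * t `^ beta) ^+ n / euler_gamma (ml_exponent m n + 1).

Definition double_term m n t : R :=
  nu ^+ m * c ^+ n / euler_gamma (ml_exponent m n + 1) * t `^ ml_exponent m n.

Let q1 : R := `|c| / K `^ beta.
Let q2 : R := nu / K.

Let K0 : 0 < K. Proof. exact: lt_trans nuK. Qed.

Let Kb0 : 0 < K `^ beta. Proof. exact: powR_gt0. Qed.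

Let q1_ge0 : 0 <= q1. Proof. by rewrite divr_ge0// ltW. Qed.

Let q1_lt1 : q1 < 1. Proof. by rewrite ltr_pdivrMr// mul1r. Qed.

Let q2_ge0 : 0 <= q2. Proof. by rewrite divr_ge0// ltW. Qed.

Let q2_lt1 : q2 < 1. Proof. by rewrite ltr_pdivrMr// mul1r. Qed.

Lemma ml_exponent_ge0 m n : 0 <= ml_exponent m n.
Proof. by rewrite addr_ge0// mulr_ge0// ltW. Qed.

Let gamma_gt0 m n : 0 < euler_gamma (ml_exponent m n + 1).
Proof. by apply: euler_gamma_gt0; rewrite lerDr ml_exponent_ge0. Qed.

Lemma powR_ml_exponent m n t : 0 <= t ->
  t `^ ml_exponent m n = (t `^ beta) ^+ n * t ^+ m.
Proof.
move=> t0; rewrite /ml_exponent; case: n => [|n].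
  by rewrite mulr0 add0r powR_mulrn// expr0 mul1r.
rewrite powRD.
  by rewrite powRrM !powR_mulrn// powR_ge0.
apply/implyP => /eqP e; exfalso.
have : 0 < beta * n.+1%:R + m%:R by rewrite ltr_wpDr// mulr_gt0.
by rewrite e ltxx.
Qed.

Lemma double_termE m n t : 0 <= t ->
  double_term m n t = nu ^+ m * t ^+ m * ml_term m n t.
Proof.
by move=> t0; rewrite /double_term powR_ml_exponent// /ml_term exprMn; ring.
Qed.

(** [euler_gamma_ge] with T = K (t + 1), which is positive even at t = 0.  Since
    t + 1 >= 1, an exponent a' smaller than a is allowed in the numerator. *)
Lemma power_div_gamma_le a' a t : 0 <= t -> 0 <= a' -> a' <= a ->
  t `^ a' / euler_gamma (a + 1) <= expR (K + 1) / K `^ a * expR (K * t).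
Proof.
move=> t0 a'0 a'a.
have a0 : 0 <= a := le_trans a'0 a'a.
have a1 : 1 <= a + 1 by lra.
have t10 : 0 < t + 1 by lra.
have T0 : 0 < K * (t + 1) by rewrite mulr_gt0.
have ta : t `^ a' <= (t + 1) `^ a.
  apply: (@le_trans _ _ ((t + 1) `^ a')); last by apply: ler_powR => //; lra.
  by apply: ge0_ler_powR => //; rewrite ?nnegrE; lra.
rewrite ler_pdivrMr ?euler_gamma_gt0//.
apply: (le_trans ta).
have := euler_gamma_ge a1 T0.
rewrite addrK powRM ?(ltW K0) ?(ltW t10)// => h.
have Ka0 : 0 < K `^ a by exact: powR_gt0.
apply: (@le_trans _ _ (expR (K + 1) / K `^ a * expR (K * t) *
   (expR (- (K * (t + 1) + 1)) * (K `^ a * (t + 1) `^ a)))); last first.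
  by rewrite ler_wpM2l// !mulr_ge0 ?expR_ge0// invr_ge0 ltW.
rewrite (_ : _ * _ = expR (K + 1) * expR (K * t) *
  expR (- (K * (t + 1) + 1)) * (t + 1) `^ a); last first.
  by field; rewrite gt_eqF.
by rewrite -!expRD (_ : K + 1 + K * t + - _ = 0) ?expR0 ?mul1r//; ring.
Qed.

Lemma powRK_ml_exponent m n :
  (K `^ ml_exponent m n)^-1 = (K `^ beta)^-1 ^+ n * K^-1 ^+ m.
Proof. by rewrite powR_ml_exponent ?(ltW K0)// invfM !exprVn. Qed.

(** This bound is separate from [double_term_bounded]: at t = 0 the convergence
    of the Mittag-Leffler series cannot be recovered from that of its multiple
    by t^m. *)
Lemma ml_term_bounded m n :
  exp_bounded K (expR (K + 1) * K^-1 ^+ m * q1 ^+ n) (ml_term m n).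
Proof.
move=> t t0; rewrite /ml_term exprMn -(mulrA (c ^+ n)) normrM [`|c ^+ n|]normrX.
have p0 : 0 <= (t `^ beta) ^+ n / euler_gamma (ml_exponent m n + 1).
  by rewrite divr_ge0 ?exprn_ge0 ?powR_ge0// ltW.
rewrite [X in _ * X]ger0_norm//.
have := @power_div_gamma_le (beta * n%:R) (ml_exponent m n) t t0.
rewrite powRrM powR_mulrn ?powR_ge0// powRK_ml_exponent => h.
apply: (@le_trans _ _ (`|c| ^+ n * (expR (K + 1) *
  ((K `^ beta)^-1 ^+ n * K^-1 ^+ m) * expR (K * t)))).
  apply: ler_wpM2l; first by rewrite exprn_ge0.
  by apply: h; rewrite ?lerDl// mulr_ge0// ltW.
by rewrite /q1 [(_ / _) ^+ n]exprMn le_eqVlt; apply/orP; left; apply/eqP; ring.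
Qed.

Lemma double_term_bounded m n :
  exp_bounded K (expR (K + 1) * q2 ^+ m * q1 ^+ n) (double_term m n).
Proof.
move=> t t0; rewrite /double_term -(mulrA (nu ^+ m * c ^+ n)) normrM normrM.
rewrite [`|nu ^+ m|]normrX [`|c ^+ n|]normrX.
have p0 : 0 <= (euler_gamma (ml_exponent m n + 1))^-1 * t `^ ml_exponent m n.
  by rewrite mulr_ge0 ?invr_ge0 ?powR_ge0// ltW.
rewrite [X in _ * X]ger0_norm// (gtr0_norm nu0).
have := @power_div_gamma_le (ml_exponent m n) (ml_exponent m n) t t0.
rewrite mulrC powRK_ml_exponent => h.
apply: (@le_trans _ _ (nu ^+ m * `|c| ^+ n * (expR (K + 1) *
  ((K `^ beta)^-1 ^+ n * K^-1 ^+ m) * expR (K * t)))).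
  apply: ler_wpM2l; first by rewrite mulr_ge0// exprn_ge0// ltW.
  by apply: h; rewrite // ml_exponent_ge0.
rewrite /q1 /q2 ![(_ / _) ^+ _]exprMn.
by rewrite le_eqVlt; apply/orP; left; apply/eqP; ring.
Qed.

Lemma double_term_within m n : {within halfline, continuous (double_term m n)}.
Proof.
by apply: within_halflineZ; exact/powR_within_halfline/ml_exponent_ge0.
Qed.

Definition ml_sum m := series_sum (ml_term m).

Definition inner_sum m := series_sum (double_term m).

Definition double_sum := series_sum inner_sum.

Lemma ml_sum_cvg m t : 0 <= t -> series (ml_term m ^~ t) @ \oo --> ml_sum m t.
Proof.
move=> t0; apply: (series_sum_cvg q1_ge0 q1_lt1 _ t0).
exact: ml_term_bounded.
Qed.

Lemma inner_sum_ml_sum m t : 0 <= t ->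
  inner_sum m t = nu ^+ m * t ^+ m * ml_sum m t.
Proof.
move=> t0; apply/cvg_lim => //.
rewrite (_ : series _ = fun N => nu ^+ m * t ^+ m * series (ml_term m ^~ t) N).
  by apply: cvgMl_tmp; exact: ml_sum_cvg.
apply/funext => N; rewrite /series/= mulr_sumr; apply: eq_bigr => n _.
by rewrite double_termE.
Qed.

Let C1 : R := expR (K + 1) / (1 - q1).

Lemma inner_sum_bounded m : exp_bounded K (C1 * q2 ^+ m) (inner_sum m).
Proof.
have -> : C1 * q2 ^+ m = expR (K + 1) * q2 ^+ m / (1 - q1) by rewrite /C1; ring.
exact: (series_sum_bounded q1_ge0 q1_lt1 (double_term_bounded m)).
Qed.

Lemma inner_sum_within m : {within halfline, continuous (inner_sum m)}.
Proof.
exact: (series_sum_within q1_ge0 q1_lt1 (@double_term_within m)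
  (double_term_bounded m)).
Qed.

Lemma double_sum_cvg t : 0 <= t -> series (inner_sum ^~ t) @ \oo --> double_sum t.
Proof. exact: (series_sum_cvg q2_ge0 q2_lt1 inner_sum_bounded). Qed.

Lemma double_sum_exp_order : exp_order K double_sum.
Proof.
exact: (series_sum_exp_order q2_ge0 q2_lt1 inner_sum_within inner_sum_bounded).
Qed.

Lemma laplace_double_term m n x y : 0 < x ->
  laplace (fun t => (double_term m n t)%:C) (x +i* y) =
  nu%:C ^+ m / (x +i* y) ^+ m.+1 * (c%:C / cpow (x +i* y) beta%:C) ^+ n.
Proof.
move=> x0; have a0 := ml_exponent_ge0 m n.
have ho : exp_order (x / 2) (fun t => t `^ ml_exponent m n).
  split; first exact: powR_within_halfline.
  by apply: exp_bounded_powR => //; lra.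
rewrite (laplaceZ _ y ho); last by lra.
rewrite laplace_power//.
have -> : (ml_exponent m n + 1)%:C = beta%:C * n%:R + m.+1%:R :> R[i].
  by rewrite /ml_exponent -addrA natr1 rmorphD rmorphM !rmorph_nat.
rewrite cpowD ?right_neq0// cpow_natr// cpow_nat//.
rewrite !rmorphM fmorphV !rmorphXn/= exprMn exprVn.
have gn0 : (euler_gamma (ml_exponent m n + 1))%:C != 0 :> R[i].
  by rewrite eq_complex/= eqxx andbT gt_eqF.
have zn0 : (x +i* y) ^+ m.+1 != 0 by rewrite expf_neq0// right_neq0.
have pn0 : cpow (x +i* y) beta%:C ^+ n != 0.
  rewrite expf_neq0//; apply/eqP => e.
  have := normc_cpow_ge y x0 (ltW beta0); rewrite e normc0.
  by apply/negP; rewrite -ltNge powR_gt0.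
by field; rewrite gn0 zn0 pn0.
Qed.

Lemma laplace_double_sum x y : K < x -> let z := x +i* y in
  laplace (fun t => (double_sum t)%:C) z =
  z^-1 / (1 - c%:C / cpow z beta%:C) / (1 - nu%:C / z).
Proof.
move=> Kx z; have x0 : 0 < x := lt_trans K0 Kx.
have nc (a : R) : normc a%:C = `|a| by rewrite /= expr0n/= addr0 sqrtr_sqr.
have r1 : normc (c%:C / cpow z beta%:C) < 1.
  rewrite normcM normcV nc ltr_pdivrMr ?mul1r.
    apply: (lt_le_trans cK); apply: le_trans (normc_cpow_ge y x0 (ltW beta0)).
    by apply: ge0_ler_powR; rewrite ?nnegrE ltW.
  exact: lt_le_trans (powR_gt0 _ x0) (normc_cpow_ge y x0 (ltW beta0)).
have r2 : normc (nu%:C / z) < 1.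
  rewrite normcM normcV nc gtr0_norm// ltr_pdivrMr ?mul1r ?normc_gt0//.
  exact: lt_le_trans (lt_trans nuK Kx) (ge_Re_normc x y).
have zn0 : z != 0 by exact: right_neq0.
apply: (laplace_geometric_series q2_ge0 q2_lt1 inner_sum_within
  inner_sum_bounded Kx r2) => m.
have := laplace_geometric_series q1_ge0 q1_lt1 (@double_term_within m)
  (double_term_bounded m) Kx r1 (fun n => laplace_double_term m n y x0).
move=> ->; rewrite exprMn exprVn exprS invfM; ring.
Qed.

End MittagLefflerDoubleSeries.

(** * Uniqueness of the inverse transform *)

Section LerchUniqueness.
Context {R : realType}.
Notation mu := (@lebesgue_measure R).
Notation halfline := (`[0%R, +oo[%classic : set R).
Implicit Types (f g : R -> R) (x y t u : R).

Definition null_integral f :=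
  mu.-integrable halfline (EFin \o f) /\ \int[mu]_(u in halfline) f u = 0.

Lemma null_integralD f g : null_integral f -> null_integral g ->
  null_integral (fun u => f u + g u).
Proof.
move=> [if_ f0] [ig g0]; split.
  by apply: (@eq_integrable _ _ _ mu _ _ ((EFin \o f) \+ (EFin \o g))%E) => //;
    exact: integrableD.
by rewrite RintegralD// f0 g0 addr0.
Qed.

Lemma null_integralZ c f : null_integral f -> null_integral (fun u => c * f u).
Proof.
move=> [if_ f0]; split; first exact: integrable_mull.
by rewrite RintegralZl// f0 mulr0.
Qed.

Lemma null_integral_sum (f_ : nat -> R -> R) N :
  (forall n, null_integral (f_ n)) -> null_integral (fun u => \sum_(n < N) f_ n u).
Proof.
move=> h; elim: N => [|N IHN].
  rewrite (_ : (fun u => _) = fun u => 0 * f_ 0 u); first exact: null_integralZ.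
  by apply/funext => u; rewrite big_ord0 mul0r.
rewrite (_ : (fun u => _) = fun u => \sum_(n < N) f_ n u + f_ N u).
  exact: null_integralD.
by apply/funext => u; rewrite big_ord_recr.
Qed.

(** Dominated convergence. *)
Lemma null_integral_limit (f_ : nat -> R -> R) f G :
    (forall n, null_integral (f_ n)) ->
    (forall u, 0 <= u -> f_ ^~ u @ \oo --> f u) ->
    mu.-integrable halfline (EFin \o G) ->
    (forall n u, 0 <= u -> `|f_ n u| <= G u) ->
  null_integral f.
Proof.
move=> f0 ff iG fG.
have mf n : measurable_fun halfline (EFin \o f_ n).
  by have [/integrableP[]] := f0 n.
have cf u : halfline u -> (EFin \o f_ n) u @[n --> \oo] --> (EFin \o f) u.
  rewrite /= in_itv/= andbT => u0; apply/fine_cvgP; split; first exact: nearW.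
  exact: ff.
have mlim : measurable_fun halfline (EFin \o f).
  by apply: (@emeasurable_fun_cvg _ _ _ _ (fun n => EFin \o f_ n)) cf => n.
have [] // := @dominated_convergence _ _ _ mu halfline _ (fun n => EFin \o f_ n)
  (EFin \o f) (EFin \o G) mf mlim _ iG.
- by apply/aeW => u; exact: cf.
- by apply/aeW => u n; rewrite /= in_itv/= andbT lee_fin => u0; exact: fG.
move=> if_ _ cint; split => //.
rewrite /Rintegral (_ : (\int[mu]_(u in halfline) (f u)%:E)%E = 0%E)//.
have E n : (\int[mu]_(u in halfline) (EFin \o f_ n) u)%E = 0%E.
  have [ifn f0n] := f0 n.
  by rewrite -[LHS]fineK ?integrable_fin_num//; congr EFin.
rewrite -(cvg_lim _ cint)//; apply/cvg_lim => //.
by under eq_fun do rewrite E; exact: cvg_cst.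
Qed.

(** The factor x, available because the constant term of the exponential series
    is omitted, keeps the partial sums of the kernel integrable against [g]. *)
Lemma exp_coeff_tail_bound x N : 0 <= x ->
  `|\sum_(j < N) exp_coeff (- x) j.+1| <= x * expR x.
Proof.
move=> x0; apply: (le_trans (ler_norm_sum _ _ _)).
apply: (@le_trans _ _ (x * series (exp_coeff x) N)).
  rewrite /series/= big_mkord mulr_sumr; apply: ler_sum => j _.
  rewrite /exp_coeff normrM normrX normrN (ger0_norm x0) ger0_norm ?invr_ge0//.
  rewrite exprS -mulrA ler_wpM2l// ler_wpM2l ?exprn_ge0//.
  rewrite lef_pV2 ?posrE ?ltr0n ?fact_gt0//.
  by rewrite ler_nat factS leq_pmull.
rewrite ler_wpM2l//; apply: (nondecreasing_cvgn_le _ (is_cvg_series_exp_coeff x)).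
apply/nondecreasing_seqP => n; rewrite /series/= big_nat_recr//= lerDl.
exact: exp_coeff_ge0.
Qed.

Lemma exp_coeff_tail_cvg x :
  (fun N => \sum_(j < N) exp_coeff (- x) j.+1) @ \oo --> expR (- x) - 1.
Proof.
have cv : series (exp_coeff (- x)) @ \oo --> expR (- x).
  exact: is_cvg_series_exp_coeff.
have cv1 : (fun N => series (exp_coeff (- x)) N.+1) @ \oo --> expR (- x).
  by rewrite cvg_shiftS.
rewrite (_ : (fun N => _) = fun N => series (exp_coeff (- x)) N.+1 - 1).
  by apply: cvgB => //; exact: cvg_cst.
apply/funext => N; rewrite /series/= big_mkord big_ord_recl.
rewrite (_ : exp_coeff (- x) ord0 = 1); last by rewrite /exp_coeff/= expr0 fact0 divr1.
by rewrite addrAC subrr add0r.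
Qed.

Section VanishingLaplace.
Variables (g : R -> R) (sigma : R).
Hypothesis cg : {within halfline, continuous g}.
Hypothesis Lg : forall x, sigma < x ->
  null_integral (fun u => expR (- (x * u)) * g u).

(** As a power series in exp(k (t - u)) without constant term, this kernel is a
    combination of the exponentials exp(- k j u) with j >= 1, against which [g]
    integrates to 0. *)
Let phragmen_kernel (k t u : R) := expR (- expR (k * (t - u))) - 1.

(** Since exp(k (t - u)) <= exp(k t), all the partial sums of the kernel are
    bounded by a constant times exp(- k u). *)
Lemma phragmen_null k t : 0 < k -> sigma < k ->
  null_integral (fun u => phragmen_kernel k t u * g u).
Proof.
move=> k0 sk.
pose f_ N u := \sum_(j < N) exp_coeff (- expR (k * (t - u))) j.+1 * g u.
apply: (@null_integral_limit f_ _
  (fun u => expR (k * t) * expR (expR (k * t)) * (expR (- (k * u)) * `|g u|))).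
- move=> N; apply: (@null_integral_sum
    (fun j u => exp_coeff (- expR (k * (t - u))) j.+1 * g u)) => j.
  rewrite (_ : (fun u => _) = fun u =>
      (-1) ^+ j.+1 * expR (k * j.+1%:R * t) / j.+1`!%:R *
      (expR (- (k * j.+1%:R * u)) * g u)).
    apply: null_integralZ; apply: Lg; apply: (lt_le_trans sk).
    by rewrite ler_pMr// ler1n.
  apply/funext => u; rewrite exp_coeffE/= [(- expR _) ^+ _]exprNn -expRM_natr.
  rewrite (_ : k * (t - u) * j.+1%:R =
    k * j.+1%:R * t + - (k * j.+1%:R * u)); last by ring.
  by rewrite expRD; ring.
- move=> u u0; rewrite (_ : (fun N => _) = fun N =>
      (\sum_(j < N) exp_coeff (- expR (k * (t - u))) j.+1) * g u).
    by apply: cvgMr_tmp; exact: exp_coeff_tail_cvg.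
  by apply/funext => N; rewrite /f_ mulr_suml.
- apply: integrable_mull.
  have [/integrable_norm i _] := Lg sk.
  apply: eq_integrable i => // u _ /=.
  by rewrite normrM ger0_norm ?expR_ge0.
- move=> N u u0; rewrite /f_ -mulr_suml normrM !mulrA ler_wpM2r//.
  apply: (le_trans (exp_coeff_tail_bound _ (expR_ge0 _))).
  have -> : expR (k * (t - u)) = expR (k * t) * expR (- (k * u)).
    by rewrite -expRD; congr expR; ring.
  rewrite -!mulrA ler_wpM2l ?expR_ge0// mulrC ler_wpM2r ?expR_ge0//.
  rewrite ler_expR ler_piMr ?expR_ge0// expR_le1 oppr_le0.
  by rewrite mulr_ge0// ltW.
Qed.

Lemma expR_expR_cvg0 a : 0 < a ->
  expR (- expR (n%:R * a)) @[n --> \oo] --> (0 : R).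
Proof.
move=> a0; apply: (@squeeze_cvgr _ _ _ _ (cst 0) (fun n => (expR (- a)) ^+ n)).
- near=> n; rewrite expR_ge0/= -expRM_natl ler_expR mulrN lerN2.
  by apply: le_trans (expR_ge1Dx _); rewrite lerDr.
- exact: cvg_cst.
- rewrite (_ : (fun n => _) = geometric 1 (expR (- a))).
    by apply: cvg_geometric; rewrite ger0_norm ?expR_ge0// expR_lt1 oppr_lt0.
  by apply/funext => n; rewrite /= mul1r.
Unshelve. all: by end_near. Qed.

Lemma expR_natN_cvg0 a : 0 < a -> expR (n%:R * - a) @[n --> \oo] --> (0 : R).
Proof.
move=> a0; rewrite (_ : (fun n => _) = geometric 1 (expR (- a))).
  by apply: cvg_geometric; rewrite ger0_norm ?expR_ge0// expR_lt1 oppr_lt0.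
by apply/funext => n; rewrite /= mul1r expRM_natl.
Qed.

(** The limit of [phragmen_null] as k tends to infinity.  From
    0 <= 1 - exp(- e) <= min(1, e) with e = exp(k (t - u)), the kernel is
    bounded by exp(k0 (t - u)) for every k >= k0, on both sides of t. *)
Lemma primitive_eq0 t : 0 <= t -> \int[mu]_(u in `[0, t]) g u = 0.
Proof.
move=> t0.
pose k0 : R := `|sigma| + 1.
have k00 : 0 < k0 by rewrite ltr_wpDl.
have sk0 : sigma < k0 by rewrite (le_lt_trans (ler_norm _))// ltrDl.
have kn n : k0 <= k0 + n%:R by rewrite lerDl.
(* The pointwise limit of the kernel times g: at u = t the kernel does not depend
   on k. *)
pose h u := (if u < t then -1 else if u == t then expR (-1) - 1 else 0) * g u.
have [ih h0] : null_integral h.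
  apply: (@null_integral_limit (fun n u => phragmen_kernel (k0 + n%:R) t u * g u) _
    (fun u => expR (k0 * t) * (expR (- (k0 * u)) * `|g u|))).
  - move=> n; apply: phragmen_null; first exact: lt_le_trans (kn n).
    exact: lt_le_trans (kn n).
  - move=> u u0; rewrite /h; apply: cvgMr_tmp; rewrite /phragmen_kernel.
    have [ut|tu|->] := ltgtP u t.
    + rewrite -[X in _ --> X]sub0r; apply: cvgB; last exact: cvg_cst.
      apply: (@squeeze_cvgr _ _ _ _ (cst 0) (fun n => expR (- expR (n%:R * (t - u))))).
      * apply: nearW => n; rewrite expR_ge0/= ler_expR lerN2 ler_expR.
        by apply: ler_wpM2r; [rewrite subr_ge0 ltW|rewrite lerDr ltW].
      * exact: cvg_cst.
      * by apply: expR_expR_cvg0; rewrite subr_gt0.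
    + rewrite [X in _ --> X](_ : 0 = expR (- 0) - 1); last by rewrite oppr0 expR0 subrr.
      apply: cvgB; last exact: cvg_cst.
      apply: (@cvg_comp _ _ _ (fun n => - expR ((k0 + n%:R) * (t - u))) expR _
        (nbhs (- 0 : R))).
        apply: cvgN.
        apply: (@squeeze_cvgr _ _ _ _ (cst 0) (fun n => expR (n%:R * - (u - t)))).
        - apply: nearW => n; rewrite expR_ge0/= ler_expR opprB.
          by apply: ler_wnM2r; [rewrite subr_le0 ltW|rewrite lerDr ltW].
        - exact: cvg_cst.
        - by apply: expR_natN_cvg0; rewrite subr_gt0.
      exact: continuous_expR.
    + by under eq_fun do rewrite subrr mulr0 expR0; exact: cvg_cst.
  - apply: integrable_mull.
    have [/integrable_norm i _] := Lg sk0.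
    apply: eq_integrable i => // u _ /=.
    by rewrite normrM ger0_norm ?expR_ge0.
  - move=> n u u0; rewrite normrM mulrA ler_wpM2r// /phragmen_kernel.
    set e := expR ((k0 + n%:R) * (t - u)).
    have e0 : 0 <= e by exact: expR_ge0.
    have e1 : 0 <= 1 - expR (- e) by rewrite subr_ge0 expR_le1 oppr_le0.
    rewrite distrC ger0_norm// -expRD.
    rewrite (_ : k0 * t + - (k0 * u) = k0 * (t - u)); last by ring.
    have [ut|tu] := leP u t.
      apply: (@le_trans _ _ 1); first by rewrite gerBl expR_ge0.
      by rewrite -expR0 ler_expR mulr_ge0 ?subr_ge0// ltW.
    apply: (@le_trans _ _ e).
      by rewrite lerBlDr -lerBlDl; apply: le_trans (expR_ge1Dx _).
    by rewrite ler_expR ler_wnM2r// subr_le0 ltW.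
have := @Rintegral_itvB _ h (BLeft 0) +oo%O t ih.
rewrite h0 => /(_ _ isT) /=; rewrite bnd_simp => /(_ t0).
rewrite (@eq_Rintegral _ _ _ mu `]t, +oo[ (cst 0)); last first.
  move=> u; rewrite inE/= in_itv/= andbT /h => tu.
  by rewrite ltNge (ltW tu)/= gt_eqF// mul0r.
rewrite Rintegral_cst// mul0r sub0r => /eqP; rewrite oppr_eq0 => /eqP ht.
have ig : mu.-integrable `[0, t] (EFin \o g).
  apply: continuous_compact_integrable; first exact: segment_compact.
  by apply: continuous_subspaceW cg; exact: subset_itvl.
rewrite -Rintegral_itv_bndo_bndc; last first.
  by apply: integrableS ig => //; apply: subset_itvl; rewrite bnd_simp.
move: ht; rewrite -Rintegral_itv_bndo_bndc; last first.
  by apply: integrableS ih => //; apply: subset_itvl.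
rewrite (@eq_Rintegral _ _ _ mu `[0, t[ (fun u => -1 * g u)); last first.
  by move=> u; rewrite inE/= in_itv/= /h => /andP[_ ->].
rewrite RintegralZl//; last first.
  by apply: integrableS ig => //; apply: subset_itvl; rewrite bnd_simp.
by rewrite mulN1r => /eqP; rewrite oppr_eq0 => /eqP.
Qed.

Lemma lerch_eq0 t : 0 <= t -> g t = 0.
Proof.
have /continuous_within_itvcyP[cg1 cg0] := cg.
have pos s : 0 < s -> g s = 0.
  move=> s0.
  have ss : s < s + 1 by rewrite ltrDl.
  have ig : mu.-integrable `[0, s + 1] (EFin \o g).
    apply: continuous_compact_integrable; first exact: segment_compact.
    by apply: continuous_subspaceW cg; exact: subset_itvl.
  have [] := @continuous_FTC1 R g (BLeft 0) s (s + 1) ss ig.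
  - by rewrite /= lte_fin.
  - by apply: cg1; rewrite in_itv/= andbT.
  move=> _ <-; rewrite derive1E.
  rewrite (@near_eq_derive _ _ _ _ (cst 0)) ?derive_cst//.
  near=> v; apply/primitive_eq0/ltW; near: v.
  exact: lt_nbhsr.
rewrite le_eqVlt => /predU1P[<-|]; last exact: pos.
apply: (@cvg_unique _ _ (g u @[u --> 0^'+])) => //.
apply: (@cvg_trans _ ((cst 0 : R -> R) u @[u --> 0^'+])); last exact: cvg_cst.
by apply: near_eq_cvg; near=> u; rewrite pos.
Unshelve. all: by end_near. Qed.

End VanishingLaplace.

End LerchUniqueness.

(** * Complex-valued limits and inverse transforms *)

Section ComplexLimits.
Context {R : realType}.
Implicit Types (a : nat -> R) (l : R).

Lemma norm_real_complex (x : R) : `|x%:C| = `|x|%:C :> R[i].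
Proof. by rewrite normc_def /= expr0n/= addr0 sqrtr_sqr. Qed.

Lemma pos_complex (e : R[i]) : 0 < e -> 0 < complex.Re e /\ e = (complex.Re e)%:C.
Proof. by case: e => x y; rewrite ltcE/= => /andP[/eqP -> x0]. Qed.

Lemma real_complex_cvg (T : Type) (F : set_system T) (f : T -> R) l :
  Filter F -> f @ F --> l -> (fun t => (f t)%:C : R[i]^o) @ F --> (l%:C : R[i]^o).
Proof.
move=> FF fl; apply/cvgrPdist_lt => e /pos_complex[e0 ->].
move/cvgrPdist_lt : fl => /(_ _ e0); apply: filterS => t ft.
by rewrite -rmorphB norm_real_complex ltcR.
Qed.

Lemma norm_Im_le (z : R[i]) : `|complex.Im z|%:C <= `|z|.
Proof.
case: z => x y; rewrite normc_def /= lecR -sqrtr_sqr ler_wsqrtr//.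
by rewrite lerDr sqr_ge0.
Qed.

Lemma Re_cvg (T : Type) (F : set_system T) (f : T -> R[i]^o) (l : R[i]^o) :
  Filter F -> f @ F --> l -> (fun t => complex.Re (f t)) @ F --> complex.Re l.
Proof.
move=> FF fl; apply/cvgrPdist_lt => e e0.
have eC : 0 < e%:C :> R[i] by rewrite ltcR.
move/cvgrPdist_lt : fl => /(_ _ eC); apply: filterS => t ft.
rewrite -ltcR; apply: le_lt_trans ft.
by rewrite -raddfB; exact: normc_ge_Re.
Qed.

Lemma Im_cvg (T : Type) (F : set_system T) (f : T -> R[i]^o) (l : R[i]^o) :
  Filter F -> f @ F --> l -> (fun t => complex.Im (f t)) @ F --> complex.Im l.
Proof.
move=> FF fl; apply/cvgrPdist_lt => e e0.
have eC : 0 < e%:C :> R[i] by rewrite ltcR.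
move/cvgrPdist_lt : fl => /(_ _ eC); apply: filterS => t ft.
rewrite -ltcR; apply: le_lt_trans ft.
by rewrite -raddfB; exact: norm_Im_le.
Qed.

Lemma csum_real a l : series a @ \oo --> l -> csum (fun n => (a n)%:C) = l%:C.
Proof.
move=> al; rewrite /csum.
have -> : series (fun n => (a n)%:C : R[i]^o) =
    fun N => ((series a N)%:C : R[i]^o).
  by apply/funext => N; rewrite /series/= rmorph_sum.
exact: (cvg_lim (@norm_hausdorff _ _) (real_complex_cvg _ al)).
Qed.

Lemma pochhammer1 n : pochhammer 1 n = (n`!)%:R :> R[i].
Proof.
rewrite /pochhammer; elim: n => [|n IHn]; first by rewrite big_ord0.
by rewrite big_ord_recr/= IHn nat1r factS mulnC natrM.
Qed.

Lemma mittag_leffler_real beta c nu K m (t : R) : 0 < beta -> 0 < nu -> nu < K ->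
    `|c| < K `^ beta -> 0 <= t ->
  mittag_leffler beta%:C m.+1%:R 1 (c * t `^ beta)%:C = (ml_sum beta c m t)%:C.
Proof.
move=> b0 nu0 nuK cK t0.
rewrite -(csum_real (@ml_sum_cvg _ _ _ _ _ b0 nu0 nuK cK m _ t0)).
rewrite /mittag_leffler; congr csum; apply/funext => n.
have -> : beta%:C * n%:R + m.+1%:R = (ml_exponent beta m n + 1)%:C :> R[i].
  by rewrite /ml_exponent -addrA natr1 rmorphD rmorphM !rmorph_nat.
rewrite cGamma_real; last by rewrite lerDr ml_exponent_ge0.
rewrite pochhammer1 /ml_term [in RHS]rmorphM fmorphV rmorphXn/=.
have fn0 : (n`!)%:R != 0 :> R[i] by rewrite pnatr_eq0 -lt0n fact_gt0.
have gn0 : (euler_gamma (ml_exponent beta m n + 1))%:C != 0 :> R[i].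
  rewrite eq_complex/= eqxx andbT gt_eqF// euler_gamma_gt0// lerDr.
  exact: ml_exponent_ge0.
by field; rewrite fn0 gn0.
Qed.

End ComplexLimits.

Section InverseLaplace.
Context {R : realType}.
Notation mu := (@lebesgue_measure R).
Notation halfline := (`[0%R, +oo[%classic : set R).
Implicit Types (F : R[i] -> R[i]) (f g : R -> R[i]).

Lemma is_inverse_laplace_congr F f g : (forall t, 0 <= t -> f t = g t) ->
  is_inverse_laplace F f -> is_inverse_laplace F g.
Proof.
move=> fg [cf [sigma Lf]]; split.
  apply: subspace_eq_continuous cf => t.
  by rewrite inE/= in_itv/= andbT => /fg.
have E s : {in halfline, laplace_integrand f s =1 laplace_integrand g s}.
  by move=> t; rewrite inE/= in_itv/= andbT => t0; rewrite /laplace_integrand fg.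
exists sigma => s /Lf[[iR iI] <-]; split; first split.
- by apply: eq_integrable iR => // t th; rewrite E.
- by apply: eq_integrable iI => // t th; rewrite E.
- by rewrite /laplace /cintegral; congr (_ +i* _); apply: eq_Rintegral => t th;
    rewrite E.
Qed.

Lemma laplace_integrand_real f (x t : R) :
  laplace_integrand f x%:C t = (expR (- (x * t)))%:C * f t.
Proof.
rewrite /laplace_integrand /cexp /= !mulr0 mul0r subr0 addr0 oppr0 cos0 sin0.
by rewrite mulr1 mulr0.
Qed.

(** The transforms at large real s suffice: there they act separately on real and
    imaginary parts, to each of which [lerch_eq0] applies. *)
Lemma is_inverse_laplace_unique F f g :
    is_inverse_laplace F f -> is_inverse_laplace F g ->
  forall t, 0 <= t -> f t = g t.
Proof.
move=> [cf [sf Lf]] [cg [sg Lg]] t t0.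
have main (part : R[i] -> R) :
    (forall h : R -> R[i], {within halfline, continuous (h : R -> R[i]^o)} ->
       {within halfline, continuous (fun u => part (h u))}) ->
    (forall x : R, Num.max sf sg < x ->
      [/\ mu.-integrable halfline (EFin \o (fun u => expR (- (x * u)) * part (f u))),
          mu.-integrable halfline (EFin \o (fun u => expR (- (x * u)) * part (g u))) &
          \int[mu]_(u in halfline) (expR (- (x * u)) * part (f u)) =
          \int[mu]_(u in halfline) (expR (- (x * u)) * part (g u))]) ->
    part (f t) = part (g t).
  move=> cpart Lpart; apply/eqP; rewrite -subr_eq0; apply/eqP.
  apply: (@lerch_eq0 R (fun u => part (f u) - part (g u)) (Num.max sf sg)) => //.
    by move=> u; apply: cvgB; exact: cpart.
  move=> x /Lpart[i1 i2 e].
  rewrite (_ : (fun u => _) = fun u => expR (- (x * u)) * part (f u) -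
    expR (- (x * u)) * part (g u)); last by apply/funext => u; rewrite mulrBr.
  split; last by rewrite RintegralB// e subrr.
  apply: (@eq_integrable _ _ _ mu _ _
    ((EFin \o (fun u => (expR (- (x * u)) * part (f u))%R)) \-
     (EFin \o (fun u => (expR (- (x * u)) * part (g u))%R)))%E) => //.
  exact: integrableB.
have ReE h (x u : R) : complex.Re (laplace_integrand h x%:C u) =
    expR (- (x * u)) * complex.Re (h u).
  by rewrite laplace_integrand_real; case: (h u) => ? ? /=; rewrite mul0r subr0.
have ImE h (x u : R) : complex.Im (laplace_integrand h x%:C u) =
    expR (- (x * u)) * complex.Im (h u).
  by rewrite laplace_integrand_real; case: (h u) => ? ? /=; rewrite mul0r addr0.
have LReE h (x : R) : complex.Re (laplace h x%:C) =
    \int[mu]_(u in halfline) (expR (- (x * u)) * complex.Re (h u)).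
  by apply: eq_Rintegral => u _; rewrite ReE.
have LImE h (x : R) : complex.Im (laplace h x%:C) =
    \int[mu]_(u in halfline) (expR (- (x * u)) * complex.Im (h u)).
  by apply: eq_Rintegral => u _; rewrite ImE.
apply: complex_eqP; apply: main.
- by move=> h ch u; apply: Re_cvg; exact: ch.
- move=> x; rewrite gt_max => /andP[fx gx].
  have [[fR _] fE] := Lf x%:C fx; have [[gR _] gE] := Lg x%:C gx.
  split.
  + by apply: eq_integrable fR => // u _; rewrite /= ReE.
  + by apply: eq_integrable gR => // u _; rewrite /= ReE.
  + by rewrite -!LReE fE gE.
- by move=> h ch u; apply: Im_cvg; exact: ch.
- move=> x; rewrite gt_max => /andP[fx gx].
  have [[_ fI] fE] := Lf x%:C fx; have [[_ gI] gE] := Lg x%:C gx.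
  split.
  + by apply: eq_integrable fI => // u _; rewrite /= ImE.
  + by apply: eq_integrable gI => // u _; rewrite /= ImE.
  + by rewrite -!LImE fE gE.
Qed.

Lemma exp_order_is_inverse_laplace F (h : R -> R) K : exp_order K h ->
    (forall x y, K < x -> laplace (fun t => (h t)%:C) (x +i* y) = F (x +i* y)) ->
  is_inverse_laplace F (fun t => (h t)%:C).
Proof.
move=> oh Lh; split.
  by move=> t; apply: real_complex_cvg; exact: oh.1.
exists K => -[x y] /= Kx; split; last exact: Lh.
split.
- have := osc_exp_order_integrable y 0 oh Kx.
  apply: eq_integrable => // t _.
  rewrite /laplace_integrand /cexp /osc /= !mulr0 !subr0 addr0.
  by rewrite add0r cosN.
- have := osc_exp_order_integrable y (- (pi / 2)) (exp_orderZ (-1) oh) Kx.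
  apply: eq_integrable => // t _.
  rewrite /laplace_integrand /cexp /osc /= !mulr0 !subr0 !add0r.
  rewrite sinN (_ : cos (y * t - pi / 2) = sin (y * t)); first by congr EFin; ring.
  by rewrite cosD cosN sinN cos_pihalf sin_pihalf; ring.
Qed.

End InverseLaplace.

(** * The expected intensity *)

Lemma complex_divr (R : realType) (a b : R) : (a / b)%:C = a%:C / b%:C :> R[i].
Proof. by rewrite rmorphM fmorphV. Qed.

(** The rational identity behind [laplace_intensity], with g = gamma,
    n = nu^beta, zb = z^beta and alpha gamma = c + g - n. *)
Lemma intensity_transform_identity (F : fieldType) (L g n c z nu zb : F) :
    c != 0 -> z != 0 -> zb != 0 -> zb - c != 0 -> z - nu != 0 ->
  L * ((n - g) / c / (z - nu) +
       (c + g - n) / c * (z^-1 / (1 - c / zb) / (1 - nu / z))) =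
  L / (z - nu) * ((g - n + zb) / (- c + zb)).
Proof.
by move=> c0 z0 zb0 zbc zn; field; rewrite ?c0 ?z0 ?zb0 ?zbc ?zn ?[- c + zb]addrC ?zbc.
Qed.

Lemma exists_growth_rate (R : realType) (beta c nu : R) : 0 < beta -> 0 < nu ->
  exists2 K, nu < K & `|c| < K `^ beta.
Proof.
move=> beta0 nu0; have c1 : 0 <= `|c| + 1 by rewrite addr_ge0.
exists (nu + 1 + (`|c| + 1) `^ beta^-1).
  by rewrite -addrA ltrDl ltr_wpDr// powR_ge0.
apply: (@lt_le_trans _ _ (((`|c| + 1) `^ beta^-1) `^ beta)).
  by rewrite -powRrM mulVf ?gt_eqF// powRr1// ltrDl.
apply: ge0_ler_powR; rewrite ?nnegrE ?powR_ge0 ?(ltW beta0)//.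
  by rewrite !addr_ge0 ?powR_ge0// ltW.
by rewrite lerDr addr_ge0// ltW.
Qed.

Section HawkesIntensity.
Context {R : realType}.
Variables (Lambda0 alpha gamma beta nu : R).
Hypothesis hbeta0 : 0 < beta.
Hypothesis hnu : 0 < nu.
Let c : R := (alpha - 1) * gamma + nu `^ beta.
Hypothesis hne : c != 0.

Variable K : R.
Hypothesis nuK : nu < K.
Hypothesis cK : `|c| < K `^ beta.

(** The constant function is written as a multiple of 1 so that both summands are
    scalar multiples of functions of known transform. *)
Definition intensity (t : R) : R :=
  Lambda0 * ((nu `^ beta - gamma) / c * 1 +
             alpha * gamma / c * (expR (- (nu * t)) * double_sum beta c nu t)).

Let K0 : 0 < K := lt_trans hnu nuK.

Let oS : exp_order K (double_sum beta c nu) :=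
  double_sum_exp_order hbeta0 hnu nuK cK.

Let oC (a : R) : exp_order K (fun=> a * 1) :=
  exp_orderZ a (exp_order_cst1 (ltW K0)).

Let oE : exp_order K (fun t => expR (- (nu * t)) * double_sum beta c nu t) :=
  exp_order_expN (ltW hnu) oS.

Lemma intensity_exp_order : exp_order K intensity.
Proof. by apply: exp_orderZ; apply: exp_orderD; [exact: oC|exact: exp_orderZ]. Qed.

Lemma laplace_intensity (x y : R) : K < x -> let s := x +i* y in
  laplace (fun t => (intensity t)%:C) s =
  Lambda0%:C / s *
    (((gamma - nu `^ beta)%:C + cpow (nu%:C + s) beta%:C) /
     ((gamma * (1 - alpha) - nu `^ beta)%:C + cpow (nu%:C + s) beta%:C)).
Proof.
move=> Kx s.
have x0 : 0 < x := lt_trans K0 Kx.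
have nx0 : 0 < nu + x by rewrite addr_gt0.
have Knx : K < nu + x by rewrite (lt_trans Kx)// ltrDr.
have zE : nu%:C + s = (nu + x) +i* y by apply: complex_eqP; rewrite /= ?add0r.
rewrite zE.
rewrite (laplaceZ _ y (exp_orderD (oC _) (exp_orderZ _ oE)) Kx).
rewrite (laplaceD y (oC _) (exp_orderZ _ oE) Kx).
rewrite (laplaceZ _ y (exp_order_cst1 (ltW K0)) Kx) laplace_cst1//.
rewrite (laplaceZ _ y oE Kx) laplace_shift.
rewrite (laplace_double_sum hbeta0 hnu nuK cK _ Knx).
set z := (nu + x) +i* y; set zb := cpow z beta%:C.
have sn0 : s != 0 by exact: right_neq0.
have zn0 : z != 0 by exact: right_neq0.
have nzb : `|c| < normc zb.
  apply: (lt_le_trans cK); apply: le_trans (normc_cpow_ge y nx0 (ltW hbeta0)).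
  by apply: ge0_ler_powR; rewrite ?nnegrE ltW.
have zb0 : zb != 0.
  by apply/eqP => e; move: nzb; rewrite e normc0 ltNge normr_ge0.
have zbc : zb - c%:C != 0.
  apply/eqP => /subr0_eq e; move: nzb.
  by rewrite e /= expr0n/= addr0 sqrtr_sqr ltxx.
have cn0 : c%:C != 0 :> R[i] by rewrite eq_complex/= eqxx andbT.
rewrite -/s (_ : s = z - nu%:C); last by rewrite /z -zE addrC addKr.
have zs : z - nu%:C != 0 by rewrite /z -zE addrC addKr.
have -> : (gamma * (1 - alpha) - nu `^ beta)%:C = - c%:C :> R[i].
  by rewrite -rmorphN/=; congr (_%:C); rewrite /c; ring.
have -> : alpha * gamma = c + gamma - nu `^ beta by rewrite /c; ring.
rewrite (complex_divr (nu `^ beta - gamma)) (complex_divr (c + gamma - _)).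
have -> : (nu `^ beta - gamma)%:C = (nu `^ beta)%:C - gamma%:C :> R[i].
  exact: rmorphB.
have -> : (gamma - nu `^ beta)%:C = gamma%:C - (nu `^ beta)%:C :> R[i].
  exact: rmorphB.
have -> : (c + gamma - nu `^ beta)%:C =
    c%:C + gamma%:C - (nu `^ beta)%:C :> R[i].
  by rewrite rmorphB rmorphD.
exact: intensity_transform_identity.
Qed.

End HawkesIntensity.

Unset Implicit Arguments.

Theorem theorem1 (R : realType) (Lambda0 alpha gamma beta nu : R)
    (hLambda0 : 0 < Lambda0) (halpha : 0 < alpha) (hgamma : 0 < gamma)
    (hbeta0 : 0 < beta) (hbeta1 : beta < 1) (hnu : 0 < nu)
    (hne : (alpha - 1) * gamma + nu `^ beta != 0)
    (lambda : R -> R[i]) :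
  is_inverse_laplace
    (fun s : R[i] =>
       Lambda0%:C / s *
       (((gamma - nu `^ beta)%:C + cpow (nu%:C + s) beta%:C) /
        ((gamma * (1 - alpha) - nu `^ beta)%:C + cpow (nu%:C + s) beta%:C)))
    lambda
  <->
  forall t : R, 0 <= t ->
    lambda t =
    Lambda0%:C *
    (((nu `^ beta - gamma) / ((alpha - 1) * gamma + nu `^ beta))%:C +
     (alpha * gamma * expR (- (nu * t)) /
        ((alpha - 1) * gamma + nu `^ beta))%:C *
     csum (fun m : nat =>
       (nu ^+ m * t ^+ m)%:C *
       mittag_leffler beta%:C m.+1%:R 1
         (((alpha - 1) * gamma + nu `^ beta) * t `^ beta)%:C)).
Proof.
set c := (alpha - 1) * gamma + nu `^ beta.
have [K nuK cK] : exists2 K, nu < K & `|c| < K `^ beta.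
  exact: exists_growth_rate.
set F := (fun s : R[i] => _).
have oI := intensity_exp_order Lambda0 hbeta0 hnu nuK cK.
have LI := @exp_order_is_inverse_laplace _ F _ _ oI
  (fun x y Kx => laplace_intensity Lambda0 hbeta0 hnu hne nuK cK y Kx).
have IE t : 0 <= t -> (intensity Lambda0 alpha gamma beta nu t)%:C =
    Lambda0%:C *
    (((nu `^ beta - gamma) / c)%:C +
     (alpha * gamma * expR (- (nu * t)) / c)%:C *
     csum (fun m : nat =>
       (nu ^+ m * t ^+ m)%:C *
       mittag_leffler beta%:C m.+1%:R 1 (c * t `^ beta)%:C)).
  move=> t0.
  have -> : (fun m : nat => (nu ^+ m * t ^+ m)%:C *
       mittag_leffler beta%:C m.+1%:R 1 (c * t `^ beta)%:C) =
      fun m => (inner_sum beta c nu m t)%:C.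
    apply/funext => m; rewrite (mittag_leffler_real m hbeta0 hnu nuK cK t0).
    by rewrite -rmorphM/= (@inner_sum_ml_sum _ _ _ _ _ hbeta0 hnu nuK cK).
  rewrite (csum_real (@double_sum_cvg _ _ _ _ _ hbeta0 hnu nuK cK _ t0)).
  rewrite -rmorphM -rmorphD -rmorphM/= /intensity -/c; congr (_ %:C); ring.
split=> [Il t t0|lE].
  by rewrite -IE//; exact: (is_inverse_laplace_unique Il LI).
by apply: is_inverse_laplace_congr LI => t t0; rewrite lE// IE.
Qed.
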